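(* For any $k\ge1$ and $n\ge 2k+3$, there exist a set $\mathcal U$ of connectors and an $r\in\{0,\dots,n-1\}$ such that: the pairs in $\mathcal U$ are pairwise disjoint (as $2$-element sets); every pair in $\mathcal U$ is disjoint from every pair in $\mathcal S_r$; and the graph $\mathcal H_{n,k}[\mathcal U]$ is connected.
   Context: $X_{n,k}$: binary strings of length $n$ with $k$ ones; positions cyclic mod $n$; $\sigma^i$ is cyclic right shift by $i$. Cyclic parenthesis matching: $1$s opening, $0$s closing brackets; each $1$ at position $i$ is matched to the last $0$ of the shortest cyclic substring starting at $i$ going right with equally many $0$s and $1$s. $f(x)$ is $x$ with all matched bits complemented; $C(x)=(x,f(x),f^2(x),\dots)$ until $x$ reappears; the set $\mathcal C_{n,k}=\{C(x):x\in X_{n,k}\}$ of these cycles partitions $X_{n,k}$. A matched pair is visible if it is not enclosed by another matched pair (no other matched pair whose cyclic interval from its $1$ to its $0$ contains both positions). $D$ is the set of Dyck words (including the empty word). A connector is an unordered pair $\{x,y\}\subseteq X_{n,k}$ such that for some $i\ge0$, $u,w\in D$ and binary strings $p,q,r'$: $x=\sigma^i(p\,1\,u\,0\,q\,0\,w\,0\,r')$, $y=\sigma^i(p\,0\,u\,0\,q\,1\,w\,0\,r')$, where in $x$ the displayed $1,0$ around $u$ are matched to each other and form a visible pair and the displayed $0$s around $w$ are unmatched. Let $s_i:=\sigma^i(1^k0^{n-k})$ (indices mod $n$), $g:=\gcd(n,k)$, $\mathcal D:=\{C(s_i):i=0,\dots,g-1\}$ (these are the cycles of $\mathcal C_{n,k}$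 containing some $s_i$), and $\mathcal S_r:=\{\{s_{r+j},s_{r+j+k+1}\}: j=0,\dots,g-2\}$. For a set $\mathcal U$ of connectors, $\mathcal H_{n,k}[\mathcal U]$ is the multigraph whose nodes are the cycles in $\mathcal C_{n,k}\setminus\mathcal D$ together with one extra node representing all of $\mathcal D$; each vertex of $X_{n,k}$ thus belongs to exactly one node, and for every $\{x,y\}\in\mathcal U$ such that $x$ and $y$ belong to different nodes, an edge is added between these two nodes. *)

(* Defs.v *)
From mathcomp Require Import all_boot.
Set Implicit Arguments. Unset Strict Implicit. Unset Printing Implicit Defensive.

Definition bstr (n : nat) := (n.-tuple bool)%type.

Definition getb n (x : bstr n) (m : nat) : bool := nth false x (m %% n).

Definition inX n k (x : bstr n) : bool := count id x == k.

Definition bal n (x : bstr n) (a L : nat) : bool :=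
  (count id [seq getb x (a + t) | t <- iota 0 L]).*2 == L.

(* the 1 at position a is matched to the 0 at position b (positions mod n):
   b is the last position of the shortest cyclic substring (length <= n)
   starting at a with equally many 0s and 1s *)
Definition mpair n (x : bstr n) (a b : nat) : bool :=
  getb x a &&
  [exists L : 'I_n.+1,
     [&& 0 < L, bal x a L,
         [forall L' : 'I_L, (0 < (L' : nat)) ==> ~~ bal x a L']
       & b %% n == (a + L - 1) %% n]].

Definition matched n (x : bstr n) (m : nat) : bool :=
  [exists a : 'I_n, mpair x a m || mpair x m a].

Definition fmap n (x : bstr n) : bstr n :=
  [tuple (getb x i (+) matched x i) | i < n].

Definition inCyc n (a b t : nat) : bool :=
  ((t + n - a %% n) %% n) <= ((b + n - a %% n) %% n).

Definition visible n (x : bstr n) (a b : nat) : bool :=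
  mpair x a b &&
  ~~ [exists a' : 'I_n, exists b' : 'I_n,
        [&& mpair x a' b',
            ((a' : nat) != a %% n) || ((b' : nat) != b %% n),
            inCyc n a' b' a & inCyc n a' b' b]].

Fixpoint dyck_from (h : nat) (s : seq bool) : bool :=
  match s with
  | [::] => h == 0
  | true :: t => dyck_from h.+1 t
  | false :: t => (0 < h) && dyck_from h.-1 t
  end.
Definition dyck (s : seq bool) : bool := dyck_from 0 s.

Definition shiftseq (n : nat) (s : seq bool) (i : nat) : seq bool :=
  [seq nth false s ((m + n - i %% n) %% n) | m <- iota 0 n].

Definition shift n (x : bstr n) (i : nat) : bstr n :=
  [tuple getb x (i0 + n - i %% n) | i0 < n].

Definition connector n k (x y : bstr n) : Prop :=
  inX k x /\ inX k y /\
  exists (i : nat) (p u q w r' : seq bool),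
    [/\ dyck u /\ dyck w,
        size (p ++ true :: u ++ false :: q ++ false :: w ++ false :: r') = n,
        val x = shiftseq n (p ++ true :: u ++ false :: q ++ false :: w ++ false :: r') i,
        val y = shiftseq n (p ++ false :: u ++ false :: q ++ true :: w ++ false :: r') i
      & [/\ visible x (size p + i) (size p + size u + 1 + i),
            ~~ matched x (size p + size u + size q + 2 + i)
          & ~~ matched x (size p + size u + size q + size w + 3 + i)]].

Definition is_connector n k (P : {set bstr n}) : Prop :=
  exists x y, P = [set x; y] /\ connector k x y.

Definition sword n k (i : nat) : bstr n := shift [tuple (i0 < k) | i0 < n] i.

Definition samecycle n (x y : bstr n) : bool := fconnect (@fmap n) x y.

Definition inD n k (x : bstr n) : bool :=
  [exists i : 'I_(gcdn n k), samecycle (sword n k i) x].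

Definition samenode n k (x y : bstr n) : bool :=
  (inD k x && inD k y) || samecycle x y.

Definition Hrel n k (U : {set {set bstr n}}) : rel (bstr n) :=
  fun x y => [&& inX k x, inX k y & samenode k x y || ([set x; y] \in U)].

(* H_{n,k}[U] is connected: any two vertices' nodes are linked by a path *)
Definition Hconnected n k (U : {set {set bstr n}}) : Prop :=
  forall x y : bstr n, inX k x -> inX k y -> connect (Hrel k U) x y.

Definition Spair n k (r j : nat) : {set bstr n} :=
  [set sword n k (r + j); sword n k (r + j + k + 1)].

(* Main.v *)
(** Reading a string as a carrier that picks up a ball at each 1 and drops one at
    each 0 turns [fmap] into the periodic box-ball system: a 0 is matched iff the
    carrier is not empty there.  The minimal length [s] of a cyclic run and the
    maximal load [L] are constant on the cycles of [fmap].

    Every cycle other than those of the rotations of 1^k 0^(n-k) (the swords)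
    contains a string [x] in which a run 1^s follows an unmatched zero, at a place
    that can be prescribed within a window of [s] consecutive positions.  Moving
    the first one of this run down to the previous unmatched zero gives a string
    [y] of maximal load at least [L]; moving it up to the unmatched zero below a
    load maximum gives a string [u] of maximal load [L + 1], attained only between
    that zero and the next one.  Both {x, y} and one of {x, u}, {u, y} are
    connectors.  A window around position 0 makes [x], [y] and, when [s] is odd,
    [u] decodable: each determines [x] and its own role, so that connectors taken
    from distinct cycles are disjoint.

    Following x -> y never decreases [L].  It can only go round in circles among
    cycles with the same [L]; but if [s] is even then the minimal run length of
    [y] is odd, so every such circle meets a cycle with [s] odd, and there the
    connector through [u], with its larger [L], is chosen instead.  Downward
    induction on [L] connects everything to the swords. *)
Require Import Defs.
From mathcomp Require Import all_boot zify.
Set Implicit Arguments. Unset Strict Implicit. Unset Printing Implicit Defensive.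

(** * Carrier loads *)

(** The obstacle is that connectors chosen on different cycles must not share a vertex. A run of
    minimal length [s] is a good marker because it cannot be torn apart: under [fmap] it alternates
    in place between ones and zeros until the zero before it is unmatched, and then jumps by exactly
    [s]; hence it meets every window of [s] positions. Decoding has to compare two markers without
    knowing their lengths, and the delicate comparisons are those between an even and an odd length.

    On cycles, the step from x to y is a functional graph, whose circles must be left without losing
    connectedness: on a circle that has an exit, exactly one event gives up {x, y}. If it uses {u,
    y} instead of {x, u}, its own x is still reached by following the rest of the circle from y.

    The bound [n >= 2k + 3] supplies a third unmatched zero, which keeps the gaps of a connector
    apart. With [r = n - 2k] all swords in the pairs of [Spair] begin in the last [2k] positions, so
    position [n - 1] is matched in them; the strings y and u have an unmatched zero there if
    [s = 1], and two separate runs of ones otherwise. *)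

Lemma eqmod_window n i j : i = j %[mod n] -> i < j + n -> j < i + n -> i = j.
Proof.
wlog le_ij : i j / i <= j => [hw|] e h1 h2.
  case: (leqP i j) => h; first exact: hw.
  by apply/esym/hw => //; lia.
have /eqP := e; rewrite eq_sym eqn_mod_dvd // => /dvdnP [q hq].
by case: q hq => [|q] hq; nia.
Qed.

Section Loads.
Variable n : nat.
Implicit Types x y T : bstr n.

Fixpoint ld (X : nat -> bool) (i : nat) : nat :=
  if i is j.+1 then (if X j then (ld X j).+1 else (ld X j).-1) else 0.

(* The carrier load just before position [i]; reading starts one full period
   earlier, which makes the load periodic. *)
Definition load x i := ld (getb x) (n + i).

Definition free x i := ~~ getb x i && (load x i == 0).

Definition light x := (count id x).*2 < n.

Definition seg x a l := [seq getb x (a + t) | t <- iota 0 l].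
Definition ones x a l := count id (seg x a l).

Lemma getb_mod x i : getb x (i %% n) = getb x i.
Proof. by rewrite /getb modn_mod. Qed.

Lemma getb_eqmod x i j : i = j %[mod n] -> getb x i = getb x j.
Proof. by rewrite /getb => ->. Qed.

Lemma getbDn x i : getb x (i + n) = getb x i.
Proof. by rewrite /getb modnDr. Qed.

Lemma getbnD x i : getb x (n + i) = getb x i.
Proof. by rewrite /getb modnDl. Qed.

Lemma bstr_eq x y : (forall i, i < n -> getb x i = getb y i) -> x = y.
Proof.
move=> h; apply/val_inj/(@eq_from_nth _ false); rewrite ?size_tuple // => i hi.
by have := h i hi; rewrite /getb modn_small.
Qed.

Lemma bstr_eq_from x y a : (forall t, t < n -> getb x (a + t) = getb y (a + t)) -> x = y.
Proof.
move=> h; apply: bstr_eq => i hi.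
have e : i = a + (i + n - a %% n) %% n %[mod n].
  rewrite modnDmr; have := divn_eq a n; have := ltn_pmod a (_ : 0 < n).
  move=> /(_ ltac:(lia)) h1 h2.
  have -> : a + (i + n - a %% n) = i + (a %/ n).+1 * n by lia.
  by rewrite addnC modnMDl.
rewrite (getb_eqmod x e) (getb_eqmod y e); apply: h.
by rewrite ltn_pmod; lia.
Qed.

Lemma loadS x i : load x i.+1 = if getb x i then (load x i).+1 else (load x i).-1.
Proof. by rewrite /load addnS /= getbnD. Qed.

Lemma ones0 x a : ones x a 0 = 0. Proof. by []. Qed.

Lemma segD x a l1 l2 : seg x a (l1 + l2) = seg x a l1 ++ seg x (a + l1) l2.
Proof.
rewrite /seg iotaD map_cat; congr (_ ++ _).
rewrite add0n -{1}(addn0 l1) iotaDl -map_comp.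
by apply: eq_map => t /=; rewrite addnA.
Qed.

Lemma segS x a l : seg x a l.+1 = getb x a :: seg x a.+1 l.
Proof. by rewrite -add1n segD addn1 /seg /= addn0. Qed.

Lemma size_seg x a l : size (seg x a l) = l.
Proof. by rewrite size_map size_iota. Qed.

Lemma nth_seg x a l t : t < l -> nth false (seg x a l) t = getb x (a + t).
Proof. by move=> h; rewrite (nth_map 0) ?size_iota // nth_iota. Qed.

Lemma eq_seg x y a l : (forall t, t < l -> getb x (a + t) = getb y (a + t)) ->
  seg x a l = seg y a l.
Proof. by move=> h; apply/eq_in_map => t; rewrite mem_iota => ht; apply: h; lia. Qed.

Lemma onesSr x a l : ones x a l.+1 = ones x a l + getb x (a + l).
Proof. by rewrite /ones -addn1 segD count_cat segS /= addn0. Qed.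

Lemma onesS x a l : ones x a l.+1 = getb x a + ones x a.+1 l.
Proof. by rewrite /ones segS. Qed.

Lemma seg0n x : seg x 0 n = x.
Proof.
apply: (@eq_from_nth _ false) => [|i]; rewrite size_seg ?size_tuple // => hi.
by rewrite nth_seg // add0n /getb modn_small.
Qed.

Lemma ones_period x a : ones x a n = count id x.
Proof.
elim: a => [|a ih]; first by rewrite /ones seg0n.
by have := onesS x a n; rewrite onesSr getbDn ih; lia.
Qed.

Lemma walk_balance x (d : nat -> nat) a l :
  (forall t, t < l -> d t.+1 = if getb x (a + t) then (d t).+1 else (d t).-1) ->
  (forall t, t < l -> ~~ getb x (a + t) -> 0 < d t) ->
  d l + l = d 0 + (ones x a l).*2.
Proof.
elim: l => [|l ih] hd hp; first by rewrite ones0; lia.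
have := hd l (ltnSn l); have := hp l (ltnSn l); rewrite onesSr.
have := ih (fun t h => hd t (ltnW h)) (fun t h => hp t (ltnW h)).
by case: (getb x (a + l)) => /= h1 h2 h3; [lia | move: (h2 isT); lia].
Qed.

Lemma load_nofree x a l : (forall t, t < l -> ~~ free x (a + t)) ->
  load x (a + l) + l = load x a + (ones x a l).*2.
Proof.
move=> h; have := @walk_balance x (fun t => load x (a + t)) a l; rewrite addn0; apply.
  by move=> t _; rewrite addnS loadS.
by move=> t /h; rewrite /free => /nandP[/negbTE->//|]; lia.
Qed.

Lemma walk_mono x (d e : nat -> nat) a l :
  (forall t, t < l -> d t.+1 = if getb x (a + t) then (d t).+1 else (d t).-1) ->
  (forall t, t < l -> e t.+1 = if getb x (a + t) then (e t).+1 else (e t).-1) ->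
  forall t0, d t0 <= e t0 -> forall t, t0 <= t <= l -> d t <= e t.
Proof.
move=> hd he t0 h0; elim=> [|t ih] ht.
  by have -> : 0 = t0 by lia.
case: (leqP t0 t) => h; last by have -> : t.+1 = t0 by lia.
have := ih ltac:(lia); rewrite hd ?he; try lia.
by case: ifP => _; lia.
Qed.

(** A walk without such a zero is never truncated, so over one period it loses
    [n - (count id x).*2 > 0], against [d 0 <= d n]. *)
Lemma walk_zero x (d : nat -> nat) a : light x ->
  (forall t, t < n -> d t.+1 = if getb x (a + t) then (d t).+1 else (d t).-1) ->
  d 0 <= d n -> exists2 t, t < n & d t = 0 /\ ~~ getb x (a + t).
Proof.
move=> hl hd h0.
case: (boolP [exists t : 'I_n, (d t == 0) && ~~ getb x (a + t)]).
  by move=> /existsP[t /andP[/eqP h1 h2]]; exists t.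
rewrite negb_exists => /forallP h.
have hp t : t < n -> ~~ getb x (a + t) -> 0 < d t.
  by move=> ht hx; have := h (Ordinal ht); rewrite /= hx andbT lt0n.
by have := walk_balance hd hp; rewrite ones_period; move: hl; rewrite /light; lia.
Qed.

(** Once [d] vanishes, [e] dominates it up to the end of the period; periodicity carries the
    domination to the start and so to the whole window. The roles can be exchanged. *)
Lemma load_window_uniq x (a : nat) (d e : nat -> nat) : light x ->
  (forall t, t < n -> d t.+1 = if getb x (a + t) then (d t).+1 else (d t).-1) ->
  (forall t, t < n -> e t.+1 = if getb x (a + t) then (e t).+1 else (e t).-1) ->
  d n = d 0 -> e n = e 0 -> forall t, t <= n -> d t = e t.
Proof.
move=> hl.
suff main d' e' :
    (forall t, t < n -> d' t.+1 = if getb x (a + t) then (d' t).+1 else (d' t).-1) ->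
    (forall t, t < n -> e' t.+1 = if getb x (a + t) then (e' t).+1 else (e' t).-1) ->
    d' n = d' 0 -> e' n = e' 0 -> forall t, t <= n -> d' t <= e' t.
  by move=> h1 h2 h3 h4 t ht; apply/eqP; rewrite eqn_leq !main.
move=> hd he hdn hen.
have [t0 ht0 [z0 _]] := walk_zero hl hd (eq_leq (esym hdn)).
have h1 := walk_mono hd he (t0 := t0); rewrite z0 in h1.
have := h1 (leq0n _) n ltac:(lia); rewrite hdn hen => h2 t ht.
exact: (walk_mono hd he h2).
Qed.

(** The reading of the second period dominates that of the first, which starts with an empty
    carrier. Where the second one vanishes the two merge, and they agree from there on. *)
Lemma loadDn x i : light x -> load x (i + n) = load x i.
Proof.
move=> hl; rewrite /load.
have hc j : ld (getb x) j <= ld (getb x) (n + j).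
  elim: j => [|j ih] //; rewrite addnS /= getbnD.
  by case: (getb x j); lia.
have hd t : t < n -> ld (getb x) (n + t.+1) =
    if getb x (0 + t) then (ld (getb x) (n + t)).+1 else (ld (getb x) (n + t)).-1.
  by move=> _; rewrite add0n addnS /= getbnD.
have h0 : ld (getb x) (n + 0) <= ld (getb x) (n + n) by rewrite addn0 hc.
have [t0 ht0 [z0 _]] := walk_zero hl hd h0.
have e j : ld (getb x) (n + (t0 + j)) = ld (getb x) (t0 + j).
  elim: j => [|j ih]; first by rewrite addn0 z0; have := hc t0; lia.
  by rewrite !addnS /= getbnD ih.
have -> : n + (i + n) = n + (t0 + (n + i - t0)) by lia.
by rewrite e; congr (ld _ _); lia.
Qed.

Lemma loadDM x i j : light x -> load x (i + j * n) = load x i.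
Proof.
move=> hl; elim: j => [|j ih]; first by rewrite addn0.
by rewrite mulSn addnCA addnC loadDn.
Qed.

Lemma load_eqmod x i j : light x -> i = j %[mod n] -> load x i = load x j.
Proof.
move=> hl e; rewrite (divn_eq i n) (divn_eq j n) e.
by rewrite ![_ * n + _]addnC !loadDM.
Qed.

Lemma free_eqmod x i j : light x -> i = j %[mod n] -> free x i = free x j.
Proof. by move=> hl e; rewrite /free (getb_eqmod x e) (load_eqmod hl e). Qed.

Lemma freeDn x i : light x -> free x (i + n) = free x i.
Proof. by move=> hl; rewrite /free getbDn loadDn. Qed.

Lemma ex_free x a : light x -> exists2 t, t < n & free x (a + t).
Proof.
move=> hl; have [||t ht [h1 h2]] := @walk_zero x (fun t => load x (a + t)) a hl.
- by move=> t _; rewrite addnS loadS.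
- by rewrite addn0 loadDn.
by exists t => //; rewrite /free h2 h1.
Qed.

(** The tool for computing loads of modified strings: it is enough to guess a periodic solution of
    the carrier recursion on one window. *)
Lemma load_uniq x a (d : nat -> nat) : light x ->
  (forall t, t < n -> d t.+1 = if getb x (a + t) then (d t).+1 else (d t).-1) ->
  d n = d 0 -> forall t, t <= n -> load x (a + t) = d t.
Proof.
move=> hl hd hdn.
apply: (@load_window_uniq x a (fun t => load x (a + t)) d hl) => //.
- by move=> t _; rewrite addnS loadS.
- by rewrite addn0 loadDn.
Qed.

Definition frees x a l := count (free x) (iota a l).

Lemma freesSr x a l : frees x a l.+1 = frees x a l + free x (a + l).
Proof. by rewrite /frees -addn1 iotaD count_cat /= addn0. Qed.

Lemma load_balance x a l :
  load x (a + l) + l = load x a + (ones x a l).*2 + frees x a l.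
Proof.
elim: l => [|l ih]; first by rewrite ones0 !addn0.
rewrite onesSr freesSr [a + l.+1]addnS loadS; move: ih; rewrite /free.
by case: (getb x (a + l)) => /=; case: (load x (a + l) =P 0); lia.
Qed.

Lemma frees_period x a : light x -> frees x a n = n - (count id x).*2.
Proof.
by move=> hl; have := load_balance x a n; rewrite loadDn // ones_period; lia.
Qed.

Lemma freesD x a l1 l2 : frees x a (l1 + l2) = frees x a l1 + frees x (a + l1) l2.
Proof. by rewrite /frees iotaD count_cat. Qed.

Lemma frees_eq0 x a l : (forall t, t < l -> ~~ free x (a + t)) -> frees x a l = 0.
Proof.
elim: l => [|l ih] h //; rewrite freesSr ih => [|t ht]; last by apply: h; lia.
by rewrite (negbTE (h l _)).
Qed.

End Loads.

(* [lia] is slow in contexts full of irrelevant boolean atoms. *)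
Ltac slia :=
  repeat match goal with
  | H : forall _, _ |- _ => clear H
  | H : is_true (free _ _) |- _ => clear H
  | H : is_true (~~ free _ _) |- _ => clear H
  | H : is_true (getb _ _) |- _ => clear H
  | H : is_true (~~ getb _ _) |- _ => clear H
  | H : is_true (light _) |- _ => clear H
  | H : is_true (inX _ _) |- _ => clear H
  | H : getb _ _ = _ |- _ => clear H
  | H : @eq (bstr _) _ _ |- _ => clear H
  | H : _ %% _ = _ %% _ |- _ => clear H
  | H : _ %% _ <> _ %% _ |- _ => clear H
  | H := _ |- _ => try unfold H in *; clearbody H
  end; lia.

(** * Parenthesis matching in terms of loads *)

Section Matching.
Variable n : nat.
Implicit Types x y T : bstr n.

Lemma light_gt0 x : light x -> 0 < n.
Proof. by rewrite /light; lia. Qed.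

Lemma getb_mktuple (F : nat -> bool) m : 0 < n ->
  getb [tuple F i | i < n] m = F (m %% n).
Proof.
move=> h; rewrite /getb.
by rewrite -[m %% n]/(val (Ordinal (ltn_pmod m h))) (nth_mktuple _ false).
Qed.

Lemma bal_ones x a l : bal x a l = ((ones x a l).*2 == l).
Proof. by []. Qed.

Lemma walk_up x a L : getb x a ->
  (forall l, 0 < l < L -> ~~ bal x a l) ->
  forall l, l <= L -> (0 < l < L -> load x a < load x (a + l)) /\
    load x (a + l) + l = load x a + (ones x a l).*2.
Proof.
move=> ha hb; elim=> [|l ih] hl; first by rewrite ones0 !addn0.
have [ih1 ih2] := ih (ltnW hl).
have e : load x (a + l.+1) + l.+1 = load x a + (ones x a l.+1).*2.
  rewrite onesSr [a + l.+1]addnS loadS; case: l ih1 ih2 hl {ih} => [|l] ih1 ih2 hl.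
    by move: ih2; rewrite !addn0 ha ones0 /=; lia.
  by have := ih1 ltac:(lia); case: (getb x (a + l.+1)); lia.
split => // h; have := hb _ h; rewrite bal_ones.
have : load x a <= load x (a + l.+1).
  case: l ih1 ih2 h {hl e ih} => [|l] ih1 ih2 h; first by rewrite addnS loadS addn0 ha leqnSn.
  rewrite [a + l.+2]addnS loadS.
  by have := ih1 ltac:(lia); case: ifP; lia.
by lia.
Qed.

Lemma mpairP x a b : reflect
  (getb x a /\ exists R, [/\ 0 < R <= n, load x (a + R) = load x a,
      forall l, 0 < l < R -> load x a < load x (a + l) & b = a + R - 1 %[mod n]])
  (mpair x a b).
Proof.
apply: (iffP andP) => [[ha /existsP[L /and4P[L0 hL /forallP hm /eqP hb]]]|].
  split=> //; exists (L : nat).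
  have hm' l : 0 < l < L -> ~~ bal x a l.
    by move=> /andP[l0 lL]; have := hm (Ordinal lL); rewrite /= l0.
  have hw := walk_up ha hm'; split => //.
  - by rewrite L0 -ltnS ltn_ord.
  - by have [_] := hw L (leqnn _); move: hL; rewrite bal_ones; lia.
  - by move=> l hl; have [/(_ hl)] := hw l ltac:(lia).
move=> [ha [R [hR e hlt hb]]]; split => //; apply/existsP.
have hRn : R < n.+1 by lia.
have nofree t : 0 < t < R -> ~~ free x (a + t).
  by move=> /hlt; rewrite /free negb_and; lia.
have e' l : 0 < l <= R -> load x (a + l) + l = load x a + (ones x a l).*2.
  case: l => [|l] hl //.
  have := @load_nofree n x a.+1 l; rewrite loadS ha onesS ha addSnnS => hh.
  by have := hh (fun t ht => eq_ind_r (fun z => ~~ free x z) (nofree t.+1 ltac:(lia)) (addSnnS a t)); lia.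
exists (Ordinal hRn); apply/and4P; split => //=.
- by lia.
- by rewrite bal_ones; have := e' R ltac:(lia); lia.
- apply/forallP => l; apply/implyP => l0; have := hlt l; rewrite l0 ltn_ord => /(_ isT).
  by rewrite bal_ones; have := e' l ltac:(have := ltn_ord l; lia); lia.
- by apply/eqP.
Qed.

Lemma first_return x a : light x -> getb x a ->
  exists R, [/\ 0 < R <= n, load x (a + R) = load x a &
      forall l, 0 < l < R -> load x a < load x (a + l)].
Proof.
move=> hl ha.
have ex : exists R, (0 < R) && (load x (a + R) <= load x a).
  by exists n; rewrite (light_gt0 hl) loadDn /=.
case: (ex_minnP ex) => R /andP[R0 hR] hmin.
have hlt l : 0 < l < R -> load x a < load x (a + l).
  by move=> h; rewrite ltnNge; apply/negP => h'; have := hmin l; rewrite h'; lia.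
exists R; split => //.
  by rewrite R0; apply: hmin; rewrite (light_gt0 hl) loadDn /=.
case: R R0 hR hmin hlt => [|[|R]] // _ hR hmin hlt.
  by move: hR; rewrite addn1 loadS ha /=; lia.
have := hlt R.+1 ltac:(lia); move: hR; rewrite [a + R.+2]addnS loadS.
by case: ifP; lia.
Qed.

Lemma matchedE x i : light x -> matched x i = getb x i || (0 < load x i).
Proof.
move=> hl; have n0 := light_gt0 hl; apply/existsP/orP.
  move=> [a /orP[]/mpairP[ha]]; last by left.
  move=> [R [hR e hlt hb]]; right; rewrite (load_eqmod hl hb).
  case: R hR e hlt {hb} => [|[|R]] hR e hlt //.
    by move: e; rewrite addn1 loadS ha /=; lia.
  by have := hlt R.+1 ltac:(lia); (have -> : a + R.+2 - 1 = a + R.+1 by lia); lia.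
have [hi _|/negbTE hi [//|h]] := boolP (getb x i).
  have [R [h1 h2 h3]] := first_return hl hi.
  exists (Ordinal (ltn_pmod (i + R - 1) n0)); apply/orP; right; apply/mpairP.
  by split => //; exists R; split => //=; rewrite modn_mod.
have [t ht /andP[_ /eqP z]] := ex_free i hl.
have t0 : 0 < t by case: t z {ht} => [|//]; rewrite addn0 => z; move: h; rewrite z.
(* The one matched to the zero at [i] is the last position below [i + n] with a load smaller than at
   [i]; the zero load at [i + t] shows that there is one. *)
pose P a := (a < i + n) && (load x a < load x i).
have exP : exists a, P a by exists (i + t); rewrite /P z; lia.
have ubP a : P a -> a <= i + n by rewrite /P; lia.
case: (ex_maxnP exP ubP) => a /andP[h1 h2] hmax.
have ait : i + t <= a by apply: hmax; rewrite /P z; lia.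
have hlt c : a < c <= i + n -> load x i <= load x c.
  move=> hc; case: (c =P i + n) => [->|hc']; first by rewrite loadDn.
  by rewrite leqNgt; apply/negP => h'; have := hmax c; rewrite /P h'; lia.
have ha : getb x a.
  by have := hlt a.+1 ltac:(lia); rewrite loadS; case: ifP => //; lia.
have ea : (load x a).+1 = load x i.
  by have := hlt a.+1 ltac:(lia); rewrite loadS ha /=; lia.
have ee : load x (a + (i + n + 1 - a)) = load x a.
  have -> : a + (i + n + 1 - a) = (i + n).+1 by lia.
  by rewrite loadS getbDn hi loadDn //; lia.
exists (Ordinal (ltn_pmod a n0)); apply/orP; left; apply/mpairP => /=.
rewrite getb_mod; split => //; exists (i + n + 1 - a).
have lm r : load x (a %% n + r) = load x (a + r).
  by apply: load_eqmod => //; rewrite modnDml.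
have := lm 0; rewrite !addn0 => lm0; rewrite lm lm0; split => //.
- by lia.
- move=> l hl'; rewrite lm; case: (a + l =P i + n) => [->|_]; first by rewrite loadDn; lia.
  by have := hlt (a + l) ltac:(lia); lia.
- rewrite -addnBA; last by lia.
  rewrite modnDml; have -> : a + (i + n + 1 - a - 1) = i + n by lia.
  by rewrite modnDr.
Qed.

Lemma getb_fmap x i : light x ->
  getb (fmap x) i = ~~ getb x i && (0 < load x i).
Proof.
move=> hl; rewrite /fmap (getb_mktuple (fun i => getb x i (+) matched x i)) ?(light_gt0 hl) //.
rewrite matchedE // getb_mod (load_eqmod hl (modn_mod i n)).
by case: getb; case: ltnP.
Qed.

(** Past the opening one of a pair the load is positive until the pair closes. As the load is 0 at
    [a], an enclosing pair must start at [a] too, and uniqueness of the first return gives it the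
    same end. *)
Lemma mpair_visible x a b : light x -> mpair x a b -> load x a = 0 -> visible x a b.
Proof.
move=> hl hm h0; have n0 := light_gt0 hl; rewrite /visible hm /=.
apply/negP => /existsP[a' /existsP[b' /and4P[hm' hne hin _]]].
move/mpairP: hm' => [ha' [R' [hR' e' hlt' hb']]].
move/mpairP: hm => [ha [R [hR e hlt hb]]].
have a'n : a' < n := ltn_ord a'; have b'n : b' < n := ltn_ord b'.
move: (nat_of_ord a') (nat_of_ord b') a'n b'n ha' e' hlt' hb' hne hin => {}a' {}b'.
move=> a'n b'n ha' e' hlt' hb' hne hin.
have e1 : a' + (a + n - a') = a + n by clear - a'n; lia.
have e2 : b' + n - a' + a' = b' + n by clear - a'n; lia.
have e3 : R' - 1 + a' = a' + R' - 1 by clear - hR'; lia.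
have [t et] : {t | t = (a + n - a') %% n} by exists ((a + n - a') %% n).
have tn : t < n by rewrite et ltn_pmod.
have aa' : a = a' + t %[mod n] by rewrite et modnDmr e1 modnDr.
have ht : t < R'.
  move: hin; rewrite /inCyc (modn_small a'n) -et => hin.
  suff h : (b' + n - a') %% n = R' - 1 by rewrite h in hin; clear - hin hR'; lia.
  rewrite -[R' - 1](@modn_small _ n); last by clear - hR'; lia.
  by apply/eqP; rewrite -(eqn_modDr a') e2 modnDr e3; apply/eqP.
case: (posnP t) => ht0; last first.
  by have := hlt' t; rewrite ht0 ht -(load_eqmod hl aa') h0 ltn0 => /(_ isT).
move: aa'; rewrite ht0 addn0 (modn_small a'n) => aa'.
have lm r : load x (a' + r) = load x (a + r).
  by apply: load_eqmod => //; rewrite -(modnDml a) aa'.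
have eR : R = R'.
  have l0 := lm 0; rewrite !addn0 h0 in l0.
  clear - h0 e e' l0 lm hlt hlt' hR hR'; case: (ltngtP R R') => // h.
    by have := hlt' R; rewrite lm l0 e h0 h; lia.
  by have := hlt R'; rewrite -lm e' l0 h0 h; lia.
move: hne; rewrite aa' eqxx /= => /negP; apply; apply/eqP.
rewrite -[b'](modn_small b'n) hb' hb -eR -!addnBA; try by clear - hR; lia.
by rewrite -(modnDml a) aa'.
Qed.

Lemma free_unmatched x i : light x -> free x i -> ~~ matched x i.
Proof. by move=> hl /andP[h1 h2]; rewrite matchedE // (negbTE h1) (eqP h2). Qed.

Definition setbit x p b : bstr n :=
  [tuple (if (i : nat) == p %% n then b else getb x i) | i < n].

Lemma getb_setbit x p b i : 0 < n ->
  getb (setbit x p b) i = if i %% n == p %% n then b else getb x i.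
Proof.
move=> n0; rewrite (getb_mktuple (fun i => if i == p %% n then b else getb x i)) //.
by rewrite getb_mod.
Qed.

Lemma modn_window_eq i p : i < p + n -> p < i + n -> (i %% n == p %% n) = (i == p).
Proof. by move=> h1 h2; apply/eqP/eqP => [h|-> //]; apply: eqmod_window h _ _. Qed.

Lemma modn_window_offset p t : t < n -> ((p + t) %% n == p %% n) = (t == 0).
Proof. by move=> h; rewrite modn_window_eq; lia. Qed.

Lemma ones_setbit x p : 0 < n -> ~~ getb x p ->
  count id (setbit x p true) = (count id x).+1.
Proof.
move=> n0 hp; rewrite -(ones_period (setbit x p true) p) -(ones_period x p).
suff h m : m.+1 = n -> ones (setbit x p true) p m.+1 = (ones x p m.+1).+1.
  by have := h n.-1 (prednK n0); rewrite (prednK n0).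
move=> em; rewrite !onesS getb_setbit // eqxx (negbTE hp); congr (_.+1).
rewrite /ones; congr (count _ _); apply: eq_seg => t ht.
by rewrite getb_setbit // addSnnS modn_window_offset // -em.
Qed.

Lemma setbit_K x p b : 0 < n -> getb x p = b -> setbit x p b = x.
Proof.
move=> n0 h; apply: bstr_eq => i _; rewrite getb_setbit //.
by case: eqP => // /(getb_eqmod x) ->.
Qed.

Lemma setbit_setbit x p b b' : 0 < n -> setbit (setbit x p b) p b' = setbit x p b'.
Proof. by move=> n0; apply: bstr_eq => i _; rewrite !getb_setbit //; case: eqP. Qed.

Lemma setbit_eqmod x p p' b : p = p' %[mod n] -> setbit x p b = setbit x p' b.
Proof. by rewrite /setbit => ->. Qed.

End Matching.

(** * Moving a one between gaps of unmatched zeros *)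

Section Gaps.
Variable n : nat.
Implicit Types x y T : bstr n.

(** The part of [T] strictly between two consecutive unmatched zeros; its bits form a Dyck word, see
    [dyck_gap]. *)
Definition gap T a b := [/\ free T a, free T b, a < b & forall i, a < i < b -> ~~ free T i].

Lemma load_free x i : free x i -> load x i = 0.
Proof. by case/andP => _ /eqP. Qed.

Lemma load_freeS x i : free x i -> load x i.+1 = 0.
Proof. by case/andP => h /eqP e; rewrite loadS (negbTE h) e. Qed.

Lemma getb_free x i : free x i -> getb x i = false.
Proof. by case/andP => /negbTE. Qed.

Lemma load_gt0 x i : ~~ free x i -> ~~ getb x i -> 0 < load x i.
Proof. by rewrite /free lt0n => h1 h2; rewrite h2 in h1. Qed.

Lemma getb_fill T a b i : 0 < n -> a < i < a + n -> getb (setbit T a b) i = getb T i.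
Proof. by move=> n0 h; rewrite getb_setbit // modn_window_eq; [case: eqP|..]; lia. Qed.

Lemma getb_fill0 T a b : 0 < n -> getb (setbit T a b) a = b.
Proof. by move=> n0; rewrite getb_setbit // eqxx. Qed.

(** The inserted one is carried to the next unmatched zero [b], which absorbs it, so nothing changes
    beyond the gap. *)
Lemma load_fill T a b i : light (setbit T a true) -> light T ->
  gap T a b -> b < a + n -> a <= i <= a + n ->
  load (setbit T a true) i = load T i + (a < i <= b).
Proof.
move=> hx hT [fa fb ab hg] bn hi; have n0 := light_gt0 hT.
have -> : i = a + (i - a) by lia.
have hr : i - a <= n by lia.
pose d t := load T (a + t) + (0 < t <= b - a).
rewrite (load_uniq (d := d) hx _ _ hr).
- by rewrite /d; congr (_ + nat_of_bool _); lia.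
- move=> t ht; rewrite /d; case: t ht => [|t] ht.
    by rewrite !addn0 getb_fill0 // addn1 (load_freeS fa) (load_free fa); lia.
  rewrite getb_fill ?[a + t.+2]addnS ?loadS; try lia.
  case: (ltngtP (a + t.+1) b) => h.
  + have := hg (a + t.+1) ltac:(lia); rewrite /free negb_and; case: ifP => /= _; lia.
  + by case: ifP; lia.
  + by rewrite h (getb_free fb) (load_free fb); lia.
- by rewrite /d addn0 loadDn //; lia.
Qed.

Lemma free_fill T a b i : light (setbit T a true) -> light T ->
  gap T a b -> b < a + n -> a <= i < a + n ->
  free (setbit T a true) i = [&& free T i, i != a & i != b].
Proof.
move=> hx hT hg bn hi; rewrite {1}/free (load_fill hx hT hg bn); last by lia.
have n0 := light_gt0 hT; case: hg => [fa fb ab hg].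
case: (i =P a) => [->|ia]; first by rewrite getb_fill0 //= andbF.
rewrite getb_fill //=; last by lia.
case: (i =P b) => [->|ib]; first by rewrite (getb_free fb) (load_free fb) ab leqnn !andbF.
rewrite andbT addn_eq0 /free andbA.
have [h|h] := boolP (a < i <= b); last by rewrite andbT.
by have := hg i ltac:(lia); rewrite /free => /negbTE ->.
Qed.

Lemma light_setbit k T a : (count id T).+1 = k -> k.*2 < n -> ~~ getb T a ->
  [/\ light T, light (setbit T a true) & inX k (setbit T a true)].
Proof.
move=> h1 h2 ha; have n0 : 0 < n by lia.
by rewrite /light /inX ones_setbit // h1 eqxx; split => //; lia.
Qed.

Lemma dyck_seg x a l : (forall t, t < l -> ~~ free x (a + t)) -> load x (a + l) = 0 ->
  dyck_from (load x a) (seg x a l).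
Proof.
elim: l a => [|l ih] a h e; first by rewrite /= -(addn0 a) e.
rewrite segS.
have hh : dyck_from (load x a.+1) (seg x a.+1 l).
  by apply: ih; rewrite ?addSnnS // => t ht; rewrite addSnnS; apply: h.
move: hh; rewrite loadS; have := h 0 isT; rewrite addn0 /free.
by case: (getb x a) => //=; rewrite -lt0n => ->.
Qed.

Lemma dyck_gap x a b : gap x a b -> dyck (seg x a.+1 (b - a - 1)).
Proof.
case=> fa fb ab hg; have := @dyck_seg x a.+1 (b - a - 1).
rewrite (load_freeS fa) (_ : a.+1 + (b - a - 1) = b); last by lia.
by rewrite (load_free fb); apply => // t ht; apply: hg; lia.
Qed.

Lemma size_shiftseq s i : size (shiftseq n s i) = n.
Proof. by rewrite size_map size_iota. Qed.

Lemma shiftseq_seg x a l : 0 < n -> l = n -> shiftseq n (seg x a l) a = x.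
Proof.
move=> n0 ->; apply: (@eq_from_nth _ false) => [|i]; rewrite size_shiftseq ?size_tuple // => hi.
rewrite (nth_map 0) ?size_iota // nth_iota // add0n nth_seg ?ltn_pmod //.
rewrite (_ : nth false x i = getb x i); last by rewrite /getb modn_small.
apply: getb_eqmod; rewrite modnDmr -modnDml.
have h : a %% n + (i + n - a %% n) = i + n by have := ltn_pmod a n0; lia.
by rewrite h modnDr.
Qed.

Lemma seg_cons_cat x a l1 l2 : seg x a (l1 + l2).+1 = getb x a :: seg x a.+1 l1 ++ seg x (a.+1 + l1) l2.
Proof. by rewrite segS segD. Qed.

(** Read from [a], the prefix of the connector is empty, and its two Dyck words are the contents of
    the gaps. In [setbit T a true] the new one is matched to [a'] and starts at load 0, hence is
    visible, while [b] and [b'] remain free. *)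
Lemma connector_gaps k T a a' b b' : (count id T).+1 = k -> k.*2 < n ->
  gap T a a' -> gap T b b' -> a' < b -> b' < a + n ->
  connector k (setbit T a true) (setbit T b true).
Proof.
move=> hk kn ga gb ab hb; have n0 : 0 < n by slia.
have [fa fa' aa' na] := ga; have [fb fb' bb' nb] := gb.
have [lT lx xX] := light_setbit hk kn (negbT (getb_free fa)).
have [_ ly yX] := light_setbit hk kn (negbT (getb_free fb)).
have {hk} _ := hk.
set x := setbit T a true in lx xX *; set y := setbit T b true in ly yX *.
have a'n : a' < a + n by slia.
have lxE := load_fill lx lT ga a'n; rewrite -/x in lxE.
have fxE := free_fill lx lT ga a'n; rewrite -/x in fxE.
have gxE i : a < i < a + n -> getb x i = getb T i by apply: getb_fill.
have gyE i : a <= i < a + n -> i != b -> getb y i = getb T i.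
  move=> hi ib; rewrite getb_setbit //.
  by rewrite modn_window_eq ?(negbTE ib) //; slia.
have gyb : getb y b = true by rewrite getb_fill0.
have gxa : getb x a = true by rewrite getb_fill0.
do 3 ?split => //.
exists a, [::], (seg T a.+1 (a' - a - 1)), (seg T a'.+1 (b - a' - 1)),
  (seg T b.+1 (b' - b - 1)), (seg T b'.+1 (a + n - b' - 1)); split.
- by split; apply: dyck_gap.
- by rewrite /= !(size_cat, size_seg) /= !(size_cat, size_seg) /= !(size_cat, size_seg) /= size_seg; slia.
- rewrite -[LHS](@shiftseq_seg x a ((a' - a - 1) + ((b - a' - 1) + ((b' - b - 1) + (a + n - b' - 1).+1).+1).+1).+1 n0); last by slia.
  congr shiftseq => /=.
  rewrite seg_cons_cat (_ : a.+1 + (a' - a - 1) = a'); last by slia.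
  rewrite seg_cons_cat (_ : a'.+1 + (b - a' - 1) = b); last by slia.
  rewrite seg_cons_cat (_ : b.+1 + (b' - b - 1) = b'); last by slia.
  rewrite segS gxa !gxE ?(getb_free fa') ?(getb_free fb) ?(getb_free fb'); try slia.
  by do ![congr (_ :: _) | congr (_ ++ _)]; apply: eq_seg => t ht; apply: gxE; slia.
- rewrite -[LHS](@shiftseq_seg y a ((a' - a - 1) + ((b - a' - 1) + ((b' - b - 1) + (a + n - b' - 1).+1).+1).+1).+1 n0); last by slia.
  congr shiftseq => /=.
  rewrite seg_cons_cat (_ : a.+1 + (a' - a - 1) = a'); last by slia.
  rewrite seg_cons_cat (_ : a'.+1 + (b - a' - 1) = b); last by slia.
  rewrite seg_cons_cat (_ : b.+1 + (b' - b - 1) = b'); last by slia.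
  rewrite segS gyb !gyE ?(getb_free fa) ?(getb_free fa') ?(getb_free fb'); try slia.
  by do ![congr (_ :: _) | congr (_ ++ _)]; apply: eq_seg => t ht; apply: gyE; slia.
- rewrite !size_seg /= !add0n; split.
  + apply: mpair_visible => //; last by rewrite lxE ?(load_free fa); slia.
    apply/mpairP; split => //; exists (a' - a).+1; split.
    * by slia.
    * rewrite addnS (_ : a + (a' - a) = a'); last by slia.
      by rewrite !lxE ?(load_free fa) ?(load_freeS fa'); slia.
    * by move=> l hl; rewrite !lxE ?(load_free fa); slia.
    * by congr (_ %% _); slia.
  + have -> : a' - a - 1 + (b - a' - 1) + 2 + a = b by slia.
    by apply: free_unmatched => //; rewrite fxE ?fb //=; slia.
  + have -> : a' - a - 1 + (b - a' - 1) + (b' - b - 1) + 3 + a = b' by slia.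
    by apply: free_unmatched => //; rewrite fxE ?fb' //=; slia.
Qed.

End Gaps.

(** * The map on strings *)

Section Flip.
Variable n : nat.
Implicit Types x y : bstr n.

(** Each position is exactly one of three things: a one of [x], a matched zero of [x] and thus a one
    of [fmap x], or a free zero. *)
Lemma ones_fmap x a l : light x -> ones x a l + ones (fmap x) a l + frees x a l = l.
Proof.
move=> hl; elim: l => [|l ih]; first by rewrite !ones0.
rewrite !onesSr freesSr getb_fmap // /free; move: ih.
by case: (getb x (a + l)) => /=; case: (load x (a + l)) => /= *; lia.
Qed.

Lemma count_fmap x : light x -> count id (fmap x) = count id x.
Proof.
move=> hl; have := ones_fmap 0 n hl; rewrite !ones_period frees_period //.
by move: hl; rewrite /light; lia.
Qed.

Lemma light_fmap x : light x -> light (fmap x).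
Proof. by move=> hl; rewrite /light count_fmap. Qed.

Lemma inX_light k x : k.*2 < n -> inX k x -> light x.
Proof. by move=> h /eqP e; rewrite /light e. Qed.

(* The load is also the load of [fmap x] read backwards. *)
Lemma load_fmap_back x i : light x ->
  load x i = if getb (fmap x) i then (load x i.+1).+1 else (load x i.+1).-1.
Proof.
move=> hl; rewrite getb_fmap // loadS.
by case: (getb x i) => /=; case: (load x i).
Qed.

(** [fmap x] alone governs the loads read backwards, and this backward walk is monotone in its
    starting value. A comparison that is trivial where the first load is 0 therefore propagates to
    the left, and symmetry gives equality. *)
Lemma fmap_inj x y : light x -> light y -> fmap x = fmap y -> x = y.
Proof.
move=> hx hy e.
suff main x' y' : light x' -> light y' -> fmap x' = fmap y' -> forall i, load x' i <= load y' i.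
  have le i : load x i = load y i by apply/eqP; rewrite eqn_leq !main.
  apply: bstr_eq => i _; have := loadS x i; rewrite !le loadS.
  by case: (getb x i); case: (getb y i); lia.
move=> hx' hy' e' i; have [t _ /load_free z] := ex_free i hx'.
have : load x' (i + t) <= load y' (i + t) by rewrite z.
elim: t {z} => [|t ih]; first by rewrite addn0.
rewrite addnS => h; apply: ih; rewrite (load_fmap_back _ hx') (load_fmap_back _ hy') e'.
by case: ifP; lia.
Qed.

End Flip.

(** * Minimal runs *)

Section Runs.
Variable n : nat.
Implicit Types x y z : bstr n.

Lemma getbDM x i j : getb x (i + j * n) = getb x i.
Proof. by apply: getb_eqmod; rewrite addnC modnMDl. Qed.

(** All maximal cyclic runs have length at least [s], expressed through the places where the bit
    changes. *)
Definition longruns s x :=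
  [forall i : 'I_n, (getb x i != getb x i.+1) ==>
     all (fun j => getb x (i.+1 + j) == getb x i.+1) (iota 0 s)].

Lemma longrunsP s x : 0 < n -> reflect
  (forall i j, getb x i != getb x i.+1 -> j < s -> getb x (i.+1 + j) = getb x i.+1)
  (longruns s x).
Proof.
move=> n0; apply: (iffP forallP) => [h i j hi hj|h i].
  have e l : getb x (i %% n + l) = getb x (i + l).
    by apply: getb_eqmod; rewrite modnDml.
  have e1 : getb x (i %% n).+1 = getb x i.+1 by rewrite -[(i %% n).+1]addn1 -[i.+1]addn1 e.
  have := h (Ordinal (ltn_pmod i n0)); rewrite /= getb_mod e1 hi.
  move=> /allP /(_ j); rewrite mem_iota => /(_ hj) /eqP.
  by rewrite addSnnS e -addSnnS.
apply/implyP => hi; apply/allP => j; rewrite mem_iota => hj.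
by apply/eqP/h.
Qed.

Lemma longruns_back s x i j : 0 < n -> longruns s x ->
  getb x (i + j) != getb x (i + j).+1 -> j < s -> getb x i = getb x (i + j).
Proof.
move=> n0 /longrunsP => /(_ n0) h hb hj; apply/eqP/negPn/negP => hne.
pose P l := (l <= j) && (getb x (i + l) != getb x (i + j)).
have exP : exists l, P l by exists 0; rewrite /P addn0 hne.
have ub l : P l -> l <= j by case/andP.
case: (ex_maxnP exP ub) => l /andP[lj hl] hm.
have lj' : l < j.
  by move: lj; rewrite leq_eqVlt => /orP[/eqP e|//]; rewrite e eqxx in hl.
have e : getb x (i + l).+1 = getb x (i + j).
  apply/eqP/negPn/negP => hne'; have := hm l.+1.
  by rewrite /P lj' addnS hne' ltnn => /(_ isT).
have := h (i + l) (j - l); rewrite e => /(_ hl) e2.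
have := e2 ltac:(slia); rewrite (_ : (i + l).+1 + (j - l) = (i + j).+1); last by slia.
by move=> e3; rewrite e3 eqxx in hb.
Qed.

(** A maximal run of exactly [s] bits [b]. Here [a] is the delimiter in front of it, so the run
    starts at [a.+1]. *)
Definition xrun x b a s :=
  [&& getb x a == ~~ b, all (fun j => getb x (a.+1 + j) == b) (iota 0 s)
    & getb x (a + s).+1 == ~~ b].

Lemma xrunP x b a s : reflect
  [/\ getb x a = ~~ b, forall i, a < i <= a + s -> getb x i = b & getb x (a + s).+1 = ~~ b]
  (xrun x b a s).
Proof.
apply: (iffP and3P) => [[/eqP h1 /allP h2 /eqP h3]|[h1 h2 h3]]; split => //.
- move=> i hi; have := h2 (i - a.+1); rewrite mem_iota.
  by rewrite (_ : a.+1 + (i - a.+1) = i) => [/(_ ltac:(slia)) /eqP //|]; slia.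
- by apply/eqP.
- by apply/allP => j; rewrite mem_iota => hj; apply/eqP/h2; slia.
- by apply/eqP.
Qed.

Lemma xrun_true_le x p s : xrun x true p s -> s <= count id x.
Proof.
case: (posnP s) => [->//|s0] /xrunP[h1 h2 _]; rewrite -(ones_period x p).
have sn : s < n.
  rewrite ltnNge; apply/negP => sn; case: (posnP n) => n0.
    by have := h2 p.+1 ltac:(slia); rewrite /getb nth_default // size_tuple n0.
  by have := h2 (p + n) ltac:(slia); rewrite getbDn h1.
have e l : l <= s -> l <= ones x p l.+1.
  elim: l => [|l ih] hl //; have := ih (ltnW hl); rewrite [ones _ _ l.+2]onesSr.
  by rewrite h2; slia.
have mono l : s < l -> s <= ones x p l.
  elim: l => // l ih; rewrite ltnS leq_eqVlt => /orP[/eqP <-|/ih h]; first exact: e.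
  by rewrite onesSr; slia.
exact: mono.
Qed.

Lemma longruns_xrun s x b a l : 0 < n -> longruns s x -> 0 < l -> xrun x b a l -> s <= l.
Proof.
move=> n0 /longrunsP => /(_ n0) h l0 /xrunP [h1 h2 h3]; rewrite leqNgt; apply/negP => hl.
have := h a l; rewrite h1 (h2 a.+1) ?addSn ?h3; last by slia.
by case: (b) => /(_ isT hl).
Qed.

Lemma longruns1 x : 0 < n -> longruns 1 x.
Proof. by move=> n0; apply/longrunsP => // i [|//] _ _; rewrite addn0. Qed.

Lemma ex_xrun x : light x -> 0 < count id x ->
  exists s b a, [/\ 0 < s, longruns s x & xrun x b a s].
Proof.
move=> hl hc; have n0 := light_gt0 hl.
have [i0 hi0] : exists i, getb x i != getb x i.+1.
  have [t _ /getb_free ht] := ex_free 0 hl.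
  case: (boolP [exists i : 'I_n, getb x (t + i) != getb x (t + i).+1]).
    by move=> /existsP[i hi]; exists (t + i).
  rewrite negb_exists => /forallP h; move: hc.
  have z l : l <= n -> getb x (t + l) = false.
    elim: l => [|l ih] hl'; first by rewrite addn0.
    have := h (Ordinal hl'); rewrite negbK => /eqP /= e.
    by rewrite addnS -e ih // ltnW.
  rewrite -(ones_period x t) /ones.
  suff : forall l, l <= n -> count id (seg x t l) = 0 by move=> ->.
  elim=> [|l ih] hln //; have := onesSr x t l; rewrite /ones => ->.
  by rewrite ih ?z // ltnW.
have exP : exists s, longruns s x by exists 1; apply: longruns1.
have ub s : longruns s x -> s <= n.
  move=> /longrunsP => /(_ n0) h; rewrite leqNgt; apply/negP => hs.
  have := h i0 n.-1 hi0 ltac:(slia).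
  rewrite addSnnS prednK // getbDn => e; by rewrite e eqxx in hi0.
(* For the largest [s] with [longruns s x], the failure of [longruns s.+1 x] exhibits a run of
   exactly this length. *)
case: (ex_maxnP exP ub) => s hs hm.
have s0 : 0 < s by apply: hm; apply: longruns1.
have : ~~ longruns s.+1 x by apply/negP => /hm; rewrite ltnn.
have /longrunsP := hs => /(_ n0) h.
rewrite negb_forall => /existsP[i]; rewrite negb_imply => /andP[hi /allPn[j]].
rewrite mem_iota => hj hne.
have ej : j = s.
  apply/eqP; rewrite eqn_leq; apply/andP; split; first by slia.
  by rewrite leqNgt; apply/negP => hj'; rewrite h ?eqxx in hne.
exists s, (getb x i.+1), i; split => //; apply/xrunP; split.
- by move: hi; case: getb; case: getb.
- move=> l hl'; rewrite -(h i (l - i.+1)) //; last by slia.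
  by congr (getb x _); slia.
- by rewrite ej addSn in hne; move: hne; case: getb; case: getb.
Qed.

Lemma load_ones x a l : (forall i, a <= i < a + l -> getb x i) -> load x (a + l) = load x a + l.
Proof.
elim: l => [|l ih] h; first by rewrite !addn0.
rewrite addnS loadS h ?ih ?addnS //; last by slia.
by move=> i hi; apply: h; slia.
Qed.

Lemma load_zeros x a l : (forall i, a <= i < a + l -> ~~ getb x i) -> load x (a + l) = load x a - l.
Proof.
elim: l => [|l ih] h; first by rewrite addn0 subn0.
rewrite addnS loadS ifN ?ih ?subnS //; last by apply: h; slia.
by move=> i hi; apply: h; slia.
Qed.

Lemma longruns_load s x i : light x -> longruns s x -> getb x i -> ~~ getb x i.+1 -> s <= load x i.+1.
Proof.
move=> hl hs h1 h2; have n0 := light_gt0 hl.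
(* Moving up by [s] periods keeps [p.+1 - s] from being truncated. *)
rewrite -(loadDM i.+1 s hl) addSn; set p := i + s * n.
have ps : s <= p.+1 by rewrite /p; nia.
have g1 : getb x p by rewrite /p getbDM.
have g2 : ~~ getb x p.+1 by rewrite /p -addSn getbDM.
rewrite (_ : p.+1 = (p.+1 - s) + s); last by slia.
rewrite load_ones ?leq_addl // => j hj.
rewrite (@longruns_back s x j (p - j) n0 hs); try slia;
  rewrite (_ : j + (p - j) = p) //; try slia.
by rewrite g1 (negbTE g2).
Qed.

(** At least [s] zeros follow, and the carrier reaches them with at least [s] balls, so the first
    [s] of them are matched. *)
Lemma fmap_after_descent s x i : light x -> longruns s x -> getb x i -> ~~ getb x i.+1 ->
  forall j, i < j <= i + s -> getb (fmap x) j.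
Proof.
move=> hl hs h1 h2 j hj; have n0 := light_gt0 hl.
have /longrunsP := hs => /(_ n0) h.
have z l : i < l <= i + s -> ~~ getb x l.
  move=> hl'; have := h i (l - i.+1); rewrite h1 (negbTE h2) => /(_ isT).
  by rewrite (_ : i.+1 + (l - i.+1) = l); [move=> ->|]; slia.
rewrite getb_fmap // z //=.
have := longruns_load hl hs h1 h2.
have := @load_zeros x i.+1 (j - i.+1) _; rewrite (_ : i.+1 + (j - i.+1) = j); last by slia.
move=> e; rewrite e; first by slia.
by move=> l hl'; apply: z; slia.
Qed.

Lemma fmap_rise x i : light x -> ~~ getb (fmap x) i -> getb (fmap x) i.+1 ->
  getb x i && ~~ getb x i.+1.
Proof.
move=> hl; rewrite !getb_fmap // loadS.
by case: (getb x i) => //=; case: (load x i) => [|l] //=; case: getb.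
Qed.

(** A rise of [fmap x] sits at a descent of [x], hence is followed by [s] ones. A run of zeros of
    [fmap x] that is too short would end at such a descent, and the ones of [x] before it would
    reach back to [i], where [fmap x] has a one. *)
Lemma longruns_fmap s x : light x -> longruns s x -> longruns s (fmap x).
Proof.
move=> hl hs; have n0 := light_gt0 hl; apply/longrunsP => // i j.
case hi: (getb (fmap x) i); case hi1: (getb (fmap x) i.+1) => // _ hj; last first.
  have /andP[g1 g2] := fmap_rise hl (negbT hi) hi1.
  by apply: fmap_after_descent g2 _ _ => //; slia.
apply/negP => hij.
pose P l := getb (fmap x) (i.+1 + l).
have exP : exists l, P l by exists j.
case: (ex_minnP exP) => l hPl hm.
have l0 : 0 < l by case: l hPl {hm} => //; rewrite /P addn0 hi1.
have hlj : l <= j by apply: hm.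
have hz : ~~ getb (fmap x) (i + l).
  apply/negP => hh; have := hm l.-1; rewrite /P (_ : i.+1 + l.-1 = i + l); last by slia.
  by move=> /(_ hh); slia.
have hPl' : getb (fmap x) (i + l).+1 by rewrite -addSn.
have /andP[g1 g2] := fmap_rise hl hz hPl'.
have := @longruns_back s x i l n0 hs; rewrite g1 (negbTE g2) => /(_ isT).
move=> /(_ ltac:(slia)) gi.
by rewrite getb_fmap // gi in hi.
Qed.

(** The carrier is empty before the run, so it picks up exactly [s] balls, drops them on the next
    [s] zeros and is empty again: the run jumps by its length. *)
Lemma xrun_fmap_free s x p : light x -> longruns s x -> 0 < s -> xrun x true p s -> free x p ->
  xrun (fmap x) true (p + s) s.
Proof.
move=> hl hs s0 /xrunP[h1 h2 h3] hf.
have g1 : getb x (p + s) by apply: h2; slia.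
apply/xrunP; split.
- by rewrite getb_fmap // g1.
- by apply: fmap_after_descent => //; rewrite h3.
have n0 := light_gt0 hl.
have l1 := @load_ones x p.+1 s; rewrite (load_freeS hf) addSn in l1.
have z : forall i, (p + s).+1 <= i < (p + s).+1 + s -> ~~ getb x i.
  move=> i hi; have /longrunsP := hs => /(_ n0) /(_ (p + s) (i - (p + s).+1)).
  rewrite g1 h3 => /(_ isT ltac:(slia)); rewrite (_ : _ + (i - _) = i); last by slia.
  by move=> ->.
have := load_zeros z; rewrite l1; last by move=> i hi; apply: h2; slia.
by rewrite getb_fmap // addSn => ->; rewrite subnn andbF.
Qed.

(** When the zero in front is matched, it and the zero behind the run both become ones, so the run
    is complemented in place. *)
Lemma xrun_fmap_true s x p : light x -> longruns s x -> 0 < s -> xrun x true p s -> ~~ free x p ->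
  xrun (fmap x) false p s.
Proof.
move=> hl hs s0 /xrunP[h1 h2 h3] hf.
have c : 0 < load x p by apply: load_gt0 => //; rewrite h1.
have g1 : getb x (p + s) by apply: h2; slia.
apply/xrunP; split.
- by rewrite getb_fmap // h1 c.
- by move=> i hi; rewrite getb_fmap // h2.
have := longruns_load hl hs g1; rewrite h3 => /(_ isT) c'.
by rewrite getb_fmap // h3 /=; slia.
Qed.

Lemma xrun_fmap_false s x p : light x -> longruns s x -> 0 < s -> xrun x false p s ->
  xrun (fmap x) true p s.
Proof.
move=> hl hs s0 /xrunP[h1 h2 h3].
apply/xrunP; split.
- by rewrite getb_fmap // h1.
- by apply: fmap_after_descent; rewrite ?h1 ?h2 //; slia.
by rewrite getb_fmap // h3.
Qed.

End Runs.

(** * Invariants and markers along a cycle *)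

Section MaxLoad.
Variable n : nat.
Implicit Types x y z : bstr n.

Definition maxload x := \max_(i < n) load x i.

Lemma load_le_max x i : light x -> load x i <= maxload x.
Proof.
move=> hl; rewrite -(load_eqmod hl (modn_mod i n)).
exact: (leq_bigmax (Ordinal (ltn_pmod i (light_gt0 hl)))).
Qed.

Lemma ex_maxload x a : light x -> exists2 P, a <= P < a + n & load x P = maxload x.
Proof.
move=> hl; have n0 := light_gt0 hl.
have [i hi] : {i : 'I_n | maxload x = load x i} by apply: eq_bigmax; rewrite card_ord.
rewrite hi; have hin := ltn_ord i; move: (nat_of_ord i) hin => {hi} {}i hin.
have ha := ltn_pmod a n0; have hb := divn_eq a n.
move: (a %% n) (a %/ n) ha hb => r q ha ->.
case: (leqP r i) => h.
  by exists (i + q * n); rewrite ?loadDM //; slia.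
by exists (i + q.+1 * n); rewrite ?loadDM // mulSn; slia.
Qed.

Lemma load_leD x a l : load x (a + l) <= load x a + l.
Proof.
elim: l => [|l ih]; first by rewrite !addn0.
by rewrite addnS loadS; case: ifP => _; slia.
Qed.

Lemma maxload_le x : light x -> maxload x <= n.
Proof.
move=> hl; have [t _ /load_free hz] := ex_free 0 hl; rewrite add0n in hz.
have [P hP <-] := ex_maxload t hl.
by have := load_leD x t (P - t); rewrite hz (_ : t + (P - t) = P); slia.
Qed.

(** From a maximum of [x] until its carrier is next empty, every ball dropped by [x] is picked up by
    [fmap x], so the sum of the two loads does not decrease. At the end all of it is load of
    [fmap x]. *)
Lemma maxload_fmap x : light x -> maxload x <= maxload (fmap x).
Proof.
move=> hl; have [P _ hP] := ex_maxload 0 hl.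
have ex : exists l, load x (P + l) == 0.
  by have [t _ /load_free h] := ex_free P hl; exists t; rewrite h.
case: (ex_minnP ex) => E /eqP hE hm.
suff h l : l <= E -> load x P <= load (fmap x) (P + l) + load x (P + l).
  by have := h E (leqnn _); rewrite hE addn0 hP => h'; apply: leq_trans h' (load_le_max _ (light_fmap hl)).
elim: l => [|l ih] hlE; first by rewrite addn0 leq_addl.
have c : 0 < load x (P + l) by rewrite lt0n; apply/negP => /hm; slia.
have := ih (ltnW hlE); rewrite addnS !loadS getb_fmap // c andbT.
by case: getb => /=; slia.
Qed.

End MaxLoad.

(** * Periodicity of the map and motion of a minimal run *)

Section Orbits.
Variables n k : nat.
Hypothesis k2n : k.*2 < n.
Implicit Types x y z : bstr n.
Local Notation X := (inX (n := n) k).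
Local Notation f := (@fmap n).

Let light x : X x -> light x. Proof. exact: inX_light. Qed.

Lemma inX_fmap x : X x -> X (f x).
Proof. by move=> hx; rewrite /inX count_fmap //; apply: light. Qed.

Lemma inX_iter t x : X x -> X (iter t f x).
Proof. by move=> hx; elim: t => //= t; apply: inX_fmap. Qed.

Lemma iter_period x : X x -> exists2 T, 0 < T & iter T f x = x.
Proof.
move=> hx; exists (order f x); first exact: order_gt0.
apply: (@iter_order_in _ f (mem [set y | X y])); last by rewrite inE.
  by move=> y; rewrite !inE; apply: inX_fmap.
by move=> y z; rewrite !inE => hy hz; apply: fmap_inj; apply: light.
Qed.

Lemma samecycle_iter x y : samecycle x y -> exists t, y = iter t f x.
Proof. by move=> /iter_findex <-; exists (findex f x y). Qed.

Lemma iter_samecycle t x : samecycle x (iter t f x).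
Proof. exact: fconnect_iter. Qed.

Lemma samecycle_refl x : samecycle x x.
Proof. exact: connect0. Qed.

Lemma samecycle_sym x y : X x -> samecycle x y -> samecycle y x.
Proof.
move=> hx hxy; have [t e] := samecycle_iter hxy.
have hy : X y by rewrite e inX_iter.
rewrite /samecycle (@fconnect_sym_in _ f (mem [set y | X y])) ?inE //.
  by move=> z; rewrite !inE; apply: inX_fmap.
by move=> z z'; rewrite !inE => hz hz'; apply: fmap_inj; apply: light.
Qed.

Lemma samecycle_trans x y z : samecycle x y -> samecycle y z -> samecycle x z.
Proof. exact: connect_trans. Qed.

Lemma samecycle_inX x y : X x -> samecycle x y -> X y.
Proof. by move=> hx /samecycle_iter[t ->]; apply: inX_iter. Qed.

Lemma longruns_orbit s x y : X x -> samecycle x y -> longruns s x -> longruns s y.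
Proof.
move=> hx /samecycle_iter[t ->] hs; elim: t => //= t; apply: longruns_fmap.
exact/light/inX_iter.
Qed.

Lemma maxload_orbit x y : X x -> samecycle x y -> maxload x = maxload y.
Proof.
move=> hx hxy; suff h x' y' : X x' -> samecycle x' y' -> maxload x' <= maxload y'.
  have hy := samecycle_inX hx hxy; have hyx := samecycle_sym hx hxy.
  by apply/eqP; rewrite eqn_leq (h _ _ hx hxy) (h _ _ hy hyx).
move=> hx' /samecycle_iter[t ->]; elim: t => //= t ih; apply: leq_trans ih _.
exact/maxload_fmap/light/inX_iter.
Qed.

Definition stuck x p := forall t, ~~ free (iter t f x) p.

(* If [p + 1] is always matched, its bit alternates; were [p] free at some time,
   it would be matched at all later times, against periodicity. *)
Lemma stuck_pred x p : X x -> stuck x p.+1 -> stuck x p.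
Proof.
move=> hx hs t0; apply/negP => hf.
pose z := iter t0 f x.
have hz : X z by apply: inX_iter.
have hsz t : ~~ free (iter t f z) p.+1 by rewrite /z -iterD; apply: hs.
have key y : X y -> ~~ free y p.+1 -> ~~ getb y p -> ~~ getb y p.+1 ->
    [/\ ~~ free y p, getb (f y) p & getb (f y) p.+1].
  move=> hy h1 h2 h3; have ly := light hy; have c1 := load_gt0 h1 h3.
  have c : 0 < load y p by move: c1; rewrite loadS (negbTE h2); slia.
  by rewrite !getb_fmap // h2 h3 c c1 /free h2 -lt0n c.
pose v := f z; have hv : X v by apply: inX_fmap.
have hsv t : ~~ free (iter t f v) p.+1 by rewrite -iterSr; apply: hsz.
have b1 : ~~ getb v p && ~~ getb v p.+1.
  rewrite !getb_fmap ?(light hz) // (load_free hf) ltnn andbF /=.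
  have := hsz 0; rewrite /free /= -/z (load_freeS hf) eqxx andbT negbK => ->.
  by [].
have step t : ~~ getb (iter t.*2 f v) p -> ~~ getb (iter t.*2 f v) p.+1 ->
    [/\ ~~ free (iter t.*2 f v) p, getb (iter t.*2.+1 f v) p & getb (iter t.*2.+1 f v) p.+1].
  by move=> h1 h2; have := key _ (inX_iter _ hv) (hsv _) h1 h2; rewrite -iterS.
have b2 t : ~~ getb (iter t.*2 f v) p && ~~ getb (iter t.*2 f v) p.+1.
  elim: t => [//|t /andP[h1 h2]]; rewrite doubleS.
  have [_ h3 h4] := step _ h1 h2.
  have hX := light (inX_iter t.*2.+1 hv).
  by rewrite iterS !(getb_fmap _ hX) h3 h4.
have b3 t : ~~ free (iter t f v) p.
  have /andP[h1 h2] := b2 t./2; have [h3 h4 _] := step _ h1 h2.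
  have := odd_double_half t; case: (odd t) => /= <-; rewrite ?add0n ?add1n //.
  by rewrite /free h4.
have [[//|T] _ eT] := iter_period hz.
by have := b3 T; rewrite -iterSr eT hf.
Qed.

(** Being stuck spreads to the left, so cyclically to every position, whereas a light string always
    has a free zero. *)
Lemma not_stuck x p : X x -> exists t, free (iter t f x) p.
Proof.
move=> hx; case: (boolP [exists t : 'I_(order f x), free (iter t f x) p]).
  by move=> /existsP[t ht]; exists t.
rewrite negb_exists => /forallP h.
have st : stuck x p.
  move=> t; have /iter_findex <- : fconnect f x (iter t f x) by apply: fconnect_iter.
  exact: (h (Ordinal (findex_max (fconnect_iter _ _ _)))).
have st2 l : l <= p -> stuck x (p - l).
  elim: l => [|l ih] hl; first by rewrite subn0.
  apply: stuck_pred => //; rewrite (_ : (p - l.+1).+1 = p - l); first by apply: ih; slia.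
  by slia.
have st3 N : stuck x (p + N * n).
  by move=> t; rewrite (free_eqmod (j := p) (light (inX_iter t hx))) ?st // addnC modnMDl.
have [t ht hf] := ex_free 0 (light hx).
have n0 : 0 < n by slia.
have st4 : stuck x t.
  have : forall l, l <= p + n -> stuck x (p + n - l).
    elim=> [|l ih] hl; first by rewrite subn0; have := st3 1; rewrite mul1n.
    apply: stuck_pred => //; rewrite (_ : (p + n - l.+1).+1 = p + n - l); first by apply: ih; slia.
    by slia.
  by move=> /(_ (p + n - t)); rewrite (_ : p + n - (p + n - t) = t); [apply|]; slia.
by have := st4 0; rewrite /= -[t]add0n hf.
Qed.

(** Induction on a time [T] at which [p] is free. Until then the run is made of ones again after
    every two steps, and in between the bit at [p] is a one, so [T] can be lowered by two. *)
Lemma marker_free s x p : X x -> 0 < s -> longruns s x -> xrun x true p s ->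
  exists t, xrun (iter t f x) true p s && free (iter t f x) p.
Proof.
move=> hx s0 hs hr; have [T hT] := not_stuck p hx.
have [N hN] := ubnP T; elim: N T x hx hs hr hT hN => // N ih T x hx hs hr hT hN.
have [hf|hf] := boolP (free x p); first by exists 0; rewrite /= hr.
have hl := light hx.
have hr1 := xrun_fmap_true hl hs s0 hr hf.
have hs1 := longruns_fmap hl hs; have hx1 := inX_fmap hx.
have hr2 := xrun_fmap_false (light hx1) hs1 s0 hr1.
case: T hT hN => [|[|T]] hT hN; first by rewrite /= (negbTE hf) in hT.
  by case/xrunP: hr1 => h1 _ _; rewrite /free /= h1 in hT.
have hT2 : free (iter T f (f (f x))) p by rewrite -!iterSr.
have hTN : T < N by slia.
have [t ht] := ih T _ (inX_fmap hx1) (longruns_fmap (light hx1) hs1) hr2 hT2 hTN.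
by exists t.+2; rewrite !iterSr.
Qed.

Lemma marker_steps s x p j : X x -> 0 < s -> longruns s x -> xrun x true p s ->
  exists t, xrun (iter t f x) true (p + j * s) s && free (iter t f x) (p + j * s).
Proof.
move=> hx s0 hs hr; elim: j => [|j [t /andP[h1 h2]]].
  by rewrite mul0n addn0; apply: marker_free.
have hxt := inX_iter t hx.
have hst := longruns_orbit hx (iter_samecycle t x) hs.
have hr1 := xrun_fmap_free (light hxt) hst s0 h1 h2.
have [t' ht'] := marker_free (inX_fmap hxt) s0 (longruns_fmap (light hxt) hst) hr1.
by exists (t' + t.+1); rewrite iterD mulSn (addnC s) addnA.
Qed.

Lemma marker_window s x p W : X x -> 0 < s -> longruns s x -> xrun x true p s ->
  exists t q, [&& W <= q < W + s, xrun (iter t f x) true q s & free (iter t f x) q].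
Proof.
move=> hx s0 hs hr.
(* The number of jumps from [p] to the first reachable position at or above [W + p * n]. The [p * n]
   places the target beyond [p] and is subtracted again in [q]. *)
pose j := (W + p * n + (s - 1) - p) %/ s; pose q := p + j * s - p * n.
have n0 : 0 < n by slia.
have hd := divn_eq (W + p * n + (s - 1) - p) s.
have hm : (W + p * n + (s - 1) - p) %% s < s by rewrite ltn_pmod.
have hpn : p <= p * n by rewrite leq_pmulr.
have e : q + p * n = p + j * s.
  by rewrite /q /j; move: hd hm; set A := _ %/ s; set B := _ %% s; move: A B => A B; slia.
have hq : W <= q < W + s.
  by rewrite /q /j; move: hd hm; set A := _ %/ s; set B := _ %% s; move: A B => A B; slia.
have [t ht] := marker_steps j hx s0 hs hr.
exists t, q; rewrite hq /=; move: ht; rewrite -e => /andP[/xrunP[h1 h2 h3] h4].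
apply/andP; split; last first.
  by rewrite (free_eqmod (j := q + p * n)) ?modnDr // ?modnDMr ?(addnC q) ?modnMDl //; apply/light/inX_iter.
apply/xrunP; split.
- by rewrite -h1 getbDM.
- by move=> i hi; rewrite -(getbDM _ i p) h2 //; slia.
- by rewrite -h3 (_ : (q + p * n + s).+1 = (q + s).+1 + p * n) ?getbDM //; slia.
Qed.

Lemma window_event s b x p W : X x -> 0 < s -> longruns s x -> xrun x b p s ->
  exists y q, [/\ samecycle x y, longruns s y, W <= q < W + s, xrun y true q s & free y q].
Proof.
move=> hx s0 hs hr.
have [x1 [c1 s1 r1]] : exists x1, [/\ samecycle x x1, longruns s x1 & xrun x1 true p s].
  case: b hr => hr; first by exists x; split => //; apply: samecycle_refl.
  exists (f x); split; first exact: (iter_samecycle 1).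
    by apply: longruns_fmap => //; apply: light.
  by apply: xrun_fmap_false => //; apply: light.
have hx1 := samecycle_inX hx c1.
have [t [q /and3P[h1 h2 h3]]] := marker_window W hx1 s0 s1 r1.
have c2 := iter_samecycle t x1.
exists (iter t f x1), q; split => //; first exact: samecycle_trans c1 c2.
exact: longruns_orbit hx1 c2 s1.
Qed.

End Orbits.

(** * Rotations of a single block of ones *)

Section Swords.
Variables n k : nat.
Hypothesis k2n : k.*2 < n.
Implicit Types x y z : bstr n.
Local Notation X := (inX (n := n) k).
Local Notation f := (@fmap n).

Let n0 : 0 < n. Proof. by slia. Qed.

Lemma getb_sword i t : t < n -> getb (sword n k i) (i + t) = (t < k).
Proof.
move=> ht; rewrite /sword /shift.
rewrite (getb_mktuple (fun j => getb [tuple (i0 < k) | i0 < n] (j + n - i %% n))) //.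
rewrite (getb_mktuple (fun j => j < k)) //; congr (_ < k).
rewrite -addnBA; last by rewrite ltnW ?ltn_pmod.
rewrite modnDml -{1}[i]/(i) {1}(divn_eq i n).
have h : i %% n <= n by rewrite ltnW ?ltn_pmod.
have -> : i %/ n * n + i %% n + t + (n - i %% n) = (i %/ n).+1 * n + t.
  by rewrite mulSn; move: h; set a := _ * n; set b := _ %% n; move: a b => a b h; slia.
by rewrite modnMDl modn_small.
Qed.

Lemma sword_mod i : sword n k (i %% n) = sword n k i.
Proof. by rewrite /sword /shift modn_mod. Qed.

Lemma ones_sword i : count id (sword n k i) = k.
Proof.
rewrite -(ones_period _ i).
suff h l : l <= n -> ones (sword n k i) i l = minn l k.
  by rewrite h // (minn_idPr _) //; slia.
elim: l => [|l ih] hl; first by rewrite ones0 min0n.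
by rewrite onesSr ih ?getb_sword ?(ltnW hl) //; slia.
Qed.

Lemma inX_sword i : X (sword n k i).
Proof. by rewrite /inX ones_sword. Qed.

Lemma load_sword i t : t <= n ->
  load (sword n k i) (i + t) = if t <= k then t else k.*2 - t.
Proof.
move=> ht; have hl : light (sword n k i) by apply: inX_light (inX_sword i).
rewrite (@load_uniq n _ i (fun t => if t <= k then t else k.*2 - t)) //.
  by move=> l hl'; rewrite getb_sword //; case: (ltngtP l k); slia.
by case: ifP => /=; slia.
Qed.

Lemma fmap_sword i : f (sword n k i) = sword n k (i + k).
Proof.
have hl : light (sword n k i) by apply: inX_light (inX_sword i).
have main t : t < n -> getb (f (sword n k i)) (i + t) = (k <= t < k.*2).
  move=> ht; rewrite getb_fmap // getb_sword // load_sword ?(ltnW ht) //.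
  by case: (ltngtP t k); slia.
apply: (bstr_eq_from (a := i + k)) => t ht; rewrite getb_sword //.
case: (ltnP (k + t) n) => h; first by rewrite -addnA main //; slia.
have -> : i + k + t = i + (k + t - n) + n by slia.
by rewrite getbDn main; slia.
Qed.

Lemma iter_sword t i : iter t f (sword n k i) = sword n k (i + t * k).
Proof.
elim: t => [|t ih]; first by rewrite addn0.
by rewrite iterS ih fmap_sword mulSn (addnC k) addnA.
Qed.

Definition is_sword x := [exists i : 'I_n, x == sword n k i].

Lemma is_swordP x : reflect (exists i, x = sword n k i) (is_sword x).
Proof.
apply: (iffP existsP) => [[i /eqP ->]|[i ->]]; first by exists i.
by exists (Ordinal (ltn_pmod i n0)); rewrite /= sword_mod.
Qed.

Lemma is_sword_orbit x y : X x -> samecycle x y -> is_sword y = is_sword x.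
Proof.
move=> hx hxy; have hy := samecycle_inX k2n hx hxy.
have h x' y' : X x' -> samecycle x' y' -> is_sword x' -> is_sword y'.
  move=> _ /samecycle_iter[t ->] /is_swordP[i ->].
  by apply/is_swordP; exists (i + t * k); rewrite iter_sword.
apply/idP/idP; last exact: h.
exact: h (samecycle_sym k2n hx hxy).
Qed.

(** [fmap] shifts swords by [k], and by Bezout some multiple of [k] is congruent to [- gcdn n k]
    modulo [n], so the orbit reaches the index [i %% gcdn n k]. *)
Lemma inD_sword i : inD k (sword n k i).
Proof.
have [a _ /dvdnP[c ec]] := Bezoutr k n0; rewrite gcdnC in ec.
have g0 : 0 < gcdn n k by rewrite gcdn_gt0 n0.
apply/existsP; exists (Ordinal (ltn_pmod i g0)) => /=.
apply: (samecycle_sym k2n (inX_sword i)).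
have -> : sword n k (i %% gcdn n k) = iter (i %/ gcdn n k * a) f (sword n k i).
  rewrite iter_sword -[LHS]sword_mod -[RHS]sword_mod; congr sword.
  have := divn_eq i (gcdn n k); move: (i %/ _) (i %% _) => q r ->.
  have -> : q * gcdn n k + r + q * a * k = q * c * n + r.
    by rewrite addnAC -mulnA -mulnDr ec mulnA.
  by rewrite modnMDl.
exact: iter_samecycle.
Qed.

Lemma sword_descent i j l : getb (sword n k i) j -> ~~ getb (sword n k i) j.+1 ->
  getb (sword n k i) l -> ~~ getb (sword n k i) l.+1 -> j = l %[mod n].
Proof.
have key j' : getb (sword n k i) j' -> ~~ getb (sword n k i) j'.+1 -> j' = i + k.-1 %[mod n].
  move=> h1 h2; pose t := (j' + (n - i %% n)) %% n.
  have ht : t < n by rewrite ltn_pmod.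
  have e : j' = i + t %[mod n].
    rewrite modnDmr addnCA -modnDmr -[in X in _ = X](modnDml i).
    have h : i %% n <= n by rewrite ltnW ?ltn_pmod.
    by rewrite subnKC // modnn addn0.
  have e1 : getb (sword n k i) j' = (t < k) by rewrite (getb_eqmod _ e) getb_sword.
  rewrite e1 in h1.
  have e2 : getb (sword n k i) j'.+1 = (t.+1 < k).
    rewrite -(@getb_sword i t.+1); last by slia.
    by apply: getb_eqmod; rewrite addnS -addn1 -[in RHS]addn1 -modnDml e modnDml.
  by rewrite e2 in h2; rewrite e; congr (_ %% n); slia.
by move=> h1 h2 h3 h4; rewrite (key j) // (key l).
Qed.

(** The last position then falls among the [k] ones or the [k] zeros matched to them. The swords in
    the pairs [Spair n k (n - k.*2) j] with [j < (gcdn n k).-1] all have such an index. *)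
Lemma sword_last_matched i : n - k.*2 <= i < n -> ~~ free (sword n k i) n.-1.
Proof.
move=> hi; rewrite /free negb_and.
have -> : n.-1 = i + (n.-1 - i) by slia.
have ht : n.-1 - i < n by slia.
rewrite negbK getb_sword // load_sword ?(ltnW ht) //.
by case: (ltngtP (n.-1 - i) k) => //= h; slia.
Qed.

Lemma sword_of_block x a s : X x -> s <= n ->
  (forall i, a < i <= a + n -> getb x i = (i <= a + s)) -> is_sword x.
Proof.
move=> hx sn h; apply/is_swordP; exists a.+1.
have e l : l <= n -> ones x a.+1 l = minn l s.
  elim: l => [|l ih] hl; first by rewrite ones0 min0n.
  by rewrite onesSr ih ?h ?(ltnW hl) //; slia.
have := e n (leqnn _); rewrite ones_period (eqP hx) (minn_idPr sn) => ek.
by apply: (bstr_eq_from (a := a.+1)) => t ht; rewrite h ?getb_sword ?ek //; slia.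
Qed.

End Swords.

(** * The strings attached to a marked cycle *)

Fixpoint last_before (Q : pred nat) m :=
  if m is m'.+1 then (if Q m' then m' else last_before Q m') else 0.

Lemma last_beforeP (Q : pred nat) m i : i < m -> Q i ->
  [/\ Q (last_before Q m), i <= last_before Q m < m
    & forall j, last_before Q m < j < m -> ~~ Q j].
Proof.
elim: m => // m ih im qi /=; case: ifP => [qm|/negbT qm].
  by split => // [|j hj]; slia.
have im' : i < m.
  by move: im; rewrite ltnS leq_eqVlt => /orP[/eqP e|//]; rewrite -e qi in qm.
have [h1 h2 h3] := ih im' qi; split => //; first by slia.
move=> j hj; case: (j =P m) => [->//|jm]; apply: h3; slia.
Qed.

Section Windows.
Variable n : nat.
Implicit Types x T : bstr n.

Lemma lift_window i a : 0 < n -> exists2 j, a <= j < a + n & j = i %[mod n].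
Proof.
move=> n0; exists (a + (i + (n - a %% n)) %% n).
  by have := ltn_pmod (i + (n - a %% n)) n0; move: (_ %% n) => r; slia.
have h : a %% n <= n by rewrite ltnW ?ltn_pmod.
by rewrite modnDmr addnCA -modnDmr -[in X in _ = X](addn0 i) -(modnDml a) subnKC // modnn.
Qed.

Lemma load_fill_ge T a b i : light (setbit T a true) -> light T ->
  gap T a b -> b < a + n -> load T i <= load (setbit T a true) i.
Proof.
move=> hx hT hg hb; have [j hj e] := lift_window i a (light_gt0 hT).
rewrite -(load_eqmod hx e) -(load_eqmod hT e) (load_fill hx hT hg hb); slia.
Qed.

Lemma gapDn T a b : light T -> gap T a b -> gap T (a + n) (b + n).
Proof.
move=> hT [h1 h2 h3 h4]; split; rewrite ?freeDn //; first by slia.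
move=> i hi; rewrite (_ : i = i - n + n); last by slia.
by rewrite freeDn //; apply: h4; slia.
Qed.

Lemma next_gap T a c : free T a -> a < c -> free T c -> exists2 b, gap T a b & b <= c.
Proof.
move=> fa ac fc.
have ex : exists b, (a < b) && free T b by exists c; rewrite ac.
case: (ex_minnP ex) => b /andP[h1 h2] hm; exists b; last by apply: hm; rewrite ac.
split => // i hi; apply/negP => fi; have := hm i; rewrite fi andbT.
by move=> /(_ ltac:(slia)); slia.
Qed.

End Windows.

Section Construction.
Variable n : nat.
Implicit Types x : bstr n.

(* [core] takes away the one at [p + 1]; [ylow] and [uhigh] put it back into the
   last unmatched zero before [p], respectively before the last load maximum
   preceding [p + n].  Positions are lifts, so [p + n] stands for [p]. *)
Definition core x p := setbit x p.+1 false.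
Definition lowgap x p := last_before (free (core x p)) p.
Definition ylow x p := setbit (core x p) (lowgap x p) true.
Definition peak x p := last_before (fun i => load x i == maxload x) (p + n).
Definition highgap x p := last_before (free (core x p)) (peak x p).
Definition uhigh x p := setbit (core x p) (highgap x p) true.

(** That [s] is the minimal run length is encoded by [longruns s x] together with a run of exactly
    this length. *)
Definition event k x p s :=
  [&& inX k x, ~~ is_sword k x, 0 < s, longruns s x, free x p & xrun x true p s].

End Construction.

(* The trace of the block of [x] at [p] once its first one, at [p + 1], has
   been moved away. *)
Definition slot n (v : bstr n) p s :=
  [/\ getb v p = false, getb v p.+1 = false,
      forall i, p.+1 < i <= p + s -> getb v i,
      forall i, p + s < i < p + s.*2 -> getb v i = false &
      (forall i, p < i <= (p + s).+1 -> load v i = i - p.+2) /\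
      (forall i, p + s < i <= p + s.*2 -> load v i = p + s.*2 - i)].

(** The common shape of [ylow] and [uhigh], with the moved one at [g]; the last equation recovers
    [x] from [v], [p] and [g]. A one at the end [p + s.*2] of the slot can only be the moved one.
    The clause about [g = (p + s.*2).+1] forbids that the moved one be isolated there and serves
    [even_odd_clash]. *)
Definition slotted n k (x : bstr n) p s (v : bstr n) g :=
  [/\ inX k v, slot v p s, getb v (p + s.*2) = (g == p + s.*2),
      [/\ p + s.*2 <= g < p + n, getb v g, load v g = 0 &
          g = (p + s.*2).+1 -> getb v g.+1] &
      x = setbit (setbit v g false) p.+1 true].

(** * Loads, gaps and connectors around one event *)

Section Event.
Variables (n k : nat) (x : bstr n) (p s : nat).
Hypothesis k3n : k.*2 + 3 <= n.
Hypothesis hev : event k x p s.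
Hypothesis np : n <= p.

Let T := core x p.
Let a := lowgap x p.
Let y := ylow x p.
Let P := peak x p.
Let G := highgap x p.
Let u := uhigh x p.

Let n0 : 0 < n. Proof. by slia. Qed.
Let k2n : k.*2 < n. Proof. by slia. Qed.

Lemma event_inX : inX k x. Proof. by case/and5P: hev. Qed.
Let xX := event_inX.
Lemma event_light : light x. Proof. exact: inX_light xX. Qed.
Let lx := event_light.
Lemma event_s0 : 0 < s. Proof. by case/and5P: hev. Qed.
Let s0 := event_s0.
Lemma event_longruns : longruns s x. Proof. by case/and5P: hev. Qed.
Let hs := event_longruns.
Lemma event_free : free x p. Proof. by case/and5P: hev => _ _ _ _ /andP[]. Qed.
Let fp := event_free.

Lemma event_bits : [/\ getb x p = false, forall i, p < i <= p + s -> getb x i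
  & forall i, p + s < i <= p + s.*2 -> getb x i = false].
Proof.
case/and5P: hev => _ _ _ _ /andP[_ /xrunP[h1 h2 h3]]; split => // i hi.
have g1 : getb x (p + s) by apply: h2; slia.
have /longrunsP := hs => /(_ n0 (p + s) (i - (p + s).+1)).
rewrite g1 h3 => /(_ isT ltac:(slia)).
by rewrite (_ : (p + s).+1 + (i - (p + s).+1) = i) //; slia.
Qed.

Lemma event_load_up i : p < i <= (p + s).+1 -> load x i = i - p.+1.
Proof.
have [h1 h2 h3] := event_bits; move=> hi.
have := @load_ones n x p.+1 (i - p.+1); rewrite (load_freeS fp).
rewrite (_ : p.+1 + (i - p.+1) = i); last by slia.
by apply => j hj; apply: h2; slia.
Qed.

Lemma event_load_down i : p + s < i <= (p + s.*2).+1 -> load x i = (p + s.*2).+1 - i.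
Proof.
have [h1 h2 h3] := event_bits; move=> hi.
have := @load_zeros n x (p + s).+1 (i - (p + s).+1); rewrite (@event_load_up (p + s).+1); last by slia.
rewrite (_ : (p + s).+1 + (i - (p + s).+1) = i); last by slia.
by move=> ->; [slia | move=> j hj; rewrite h3 //; slia].
Qed.

Lemma event_sk : s <= k.
Proof.
by case/and5P: hev => /eqP <- _ _ _ /andP[_ h]; apply: xrun_true_le h.
Qed.
Let sk := event_sk.

Lemma core_xK : setbit T p.+1 true = x.
Proof.
rewrite /T /core setbit_setbit // setbit_K //.
by have [_ h _] := event_bits; apply: h; slia.
Qed.

Lemma getb_core_p1 : getb T p.+1 = false.
Proof. by rewrite /T /core getb_fill0. Qed.

Lemma count_core : (count id T).+1 = k.
Proof.
have := @ones_setbit n T p.+1 n0; rewrite getb_core_p1 core_xK => /(_ isT) <-.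
exact/eqP.
Qed.

Lemma light_core : light T.
Proof. by rewrite /light; have := count_core; slia. Qed.
Let lT := light_core.

Lemma getb_core i : p.+1 < i <= p + n -> getb T i = getb x i.
Proof. by move=> hi; rewrite /T /core getb_fill //; slia. Qed.

(** In [x] the one at [p.+1] is matched to the zero at [p + s.*2]; without it the carrier holds one
    ball less in between. *)
Lemma load_core i : p < i <= p.+1 + n -> load T i = load x i - (p.+1 < i <= p + s.*2).
Proof.
move=> hi; have hr : i - p.+1 <= n by slia.
have [h1 h2 h3] := event_bits.
pose d t := load x (p.+1 + t) - (0 < t < s.*2).
have -> : i = p.+1 + (i - p.+1) by slia.
rewrite (load_uniq (d := d) lT _ _ hr).
- by rewrite /d; congr (_ - nat_of_bool _); slia.
- move=> t ht; rewrite /d; case: t ht => [|t] ht.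
    by rewrite addn0 getb_core_p1 addn1 (@event_load_up p.+1) ?(@event_load_up p.+2); slia.
  rewrite getb_core ?[p.+1 + t.+2]addnS ?(loadS x (p.+1 + t.+1)); try slia.
  case: (ltngtP t.+2 s.*2) => h.
  + have c : 0 < load x (p.+1 + t.+1).
      case: (leqP (t.+1) s) => ts; first by rewrite event_load_up; slia.
      by rewrite event_load_down; slia.
    by move: c; case: ifP => _; slia.
  + by case: ifP => _; slia.
  + have e : load x (p.+1 + t.+1) = 1 by rewrite event_load_down; slia.
    by rewrite h3 ?e; slia.
- by rewrite /d addn0 loadDn //; slia.
Qed.

Lemma free_core i : p < i <= p + n ->
  free T i = [|| free x i, i == p.+1 | i == p + s.*2].
Proof.
have [h1 h2 h3] := event_bits; move=> hi.
rewrite {1}/free load_core; last by slia.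
case: (i =P p.+1) => [->|hi1].
  by rewrite getb_core_p1 event_load_up ?orbT /=; slia.
rewrite getb_core; last by slia.
case: (leqP i (p + s)) => his.
  rewrite /free h2 /=; last by slia.
  by case: eqP => //; slia.
case: (leqP i (p + s.*2)) => his2.
  by rewrite /free h3 ?event_load_down /=; try slia; case: eqP; slia.
rewrite andbF subn0 -/(free x i).
by rewrite (_ : (i == p + s.*2) = false) ?orbF //; slia.
Qed.

Lemma core_free_p : free T (p + n).
Proof. by rewrite free_core ?freeDn ?fp //; slia. Qed.

Lemma core_free_p0 : free T p.
Proof. by rewrite -freeDn // core_free_p. Qed.

Lemma core_free_p1 : free T p.+1.
Proof. by rewrite free_core ?eqxx ?orbT //; slia. Qed.

Lemma core_free_end : free T (p + s.*2).
Proof. by rewrite free_core ?eqxx ?orbT //; slia. Qed.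

Lemma event_nofree i : p < i <= p + s.*2 -> ~~ free x i.
Proof.
have [h1 h2 h3] := event_bits; move=> hi; rewrite /free.
case: (leqP i (p + s)) => his; first by rewrite h2; slia.
by rewrite h3 ?event_load_down; slia.
Qed.

Lemma core_block_gap : gap T p.+1 (p + s.*2).
Proof.
split; [exact: core_free_p1 | exact: core_free_end | slia | move=> i hi].
by rewrite free_core ?negb_or ?event_nofree; slia.
Qed.

Lemma lowgap_gap : gap T a p /\ p - n <= a.
Proof.
have f0 : free T (p - n) by rewrite -freeDn // subnK // core_free_p0.
have hp : p - n < p by slia.
have [h1 h2 h3] : [/\ free T a, p - n <= a < p & forall j, a < j < p -> ~~ free T j].
  exact: last_beforeP hp f0.
split; last by slia.
by split => //; [exact: core_free_p0 | slia].
Qed.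

Lemma lowgap_gapn : gap T (a + n) (p + n).
Proof. by have [h _] := lowgap_gap; apply: gapDn. Qed.

(* This is where [n >= 2k + 3] enters. *)
Lemma third_zero : exists2 f1, free T f1 & p + s.*2 < f1 < a + n.
Proof.
have spn : p + s.*2 < p + n by slia.
have [f1 [_ hf1 h1 h2] h3] := next_gap core_free_end spn core_free_p.
exists f1 => //; rewrite h1 /= ltnNge; apply/negP => haf.
have [_ _ _ hg] := lowgap_gapn.
(* If [a + n <= f1], the only possible free zeros of [x] in a period would be [f1] and [p + n], but
   there are [n - k.*2 >= 3] of them. *)
have hf L : L = n -> frees x p.+1 L = n - k.*2.
  by move=> ->; rewrite frees_period // (eqP xX).
have z1 i : p < i < f1 -> ~~ free x i.
  move=> hi; case: (leqP i (p + s.*2)) => h; first by apply: event_nofree; slia.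
  by have := h2 i ltac:(slia); rewrite free_core ?negb_or; [case/andP|slia].
have z2 i : f1 < i < p + n -> ~~ free x i.
  move=> hi; have := hg i ltac:(slia); rewrite free_core ?negb_or; [by case/andP|slia].
have one i : frees x i 1 <= 1 by rewrite /frees /=; case: free.
have e1 : frees x p.+1 (f1 - p.+1) = 0.
  by apply: frees_eq0 => t ht; apply: z1; slia.
move: h3; rewrite leq_eqVlt => /orP[/eqP ef|h3].
  have e : (f1 - p.+1) + 1 = n by slia.
  have := hf _ e; rewrite freesD e1; have := one (p.+1 + (f1 - p.+1)); slia.
have e : (f1 - p.+1) + 1 + (p + n - f1.+1) + 1 = n by slia.
have e2 : frees x (p.+1 + (f1 - p.+1 + 1)) (p + n - f1.+1) = 0.
  by apply: frees_eq0 => t ht; apply: z2; slia.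
have := hf _ e; rewrite !freesD e1 e2.
have := one (p.+1 + (f1 - p.+1)); have := one (p.+1 + (f1 - p.+1 + 1 + (p + n - f1.+1))).
by slia.
Qed.

Lemma lowgap_bounds : p + s.*2 < a + n < p + n.
Proof. by have [f1 _ h] := third_zero; have [[_ _ h' _] _] := lowgap_gap; slia. Qed.

Lemma maxload_gt0 : 0 < maxload x.
Proof.
apply: leq_trans (load_le_max (p + s).+1 lx).
by rewrite event_load_up; slia.
Qed.

(* Since [x] is not a sword, a further run of ones, of length at least [s],
   lies outside the block starting at [p]. *)
Lemma peak_exists : exists2 i, p + s.*2 < i < p + n & load x i = maxload x.
Proof.
have [h1 h2 h3] := event_bits.
have [i hi ei] := ex_maxload p.+1 lx.
case: (leqP i (p + s.*2)) => his; last first.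
  exists i => //; rewrite his /=; case: (ltngtP i (p + n)) => // h; first by slia.
  by move: ei; rewrite h loadDn // (load_free fp); have := maxload_gt0; slia.
(* A maximum over the block is at most [s]. After the last one before [p + n] the load is at least
   [s], so the maximum is also attained outside the block. *)
have Ls : maxload x <= s.
  rewrite -ei; case: (leqP i (p + s)) => h; first by rewrite event_load_up; slia.
  by rewrite event_load_down; slia.
have [j hj1 hj2] : exists2 j, p + s.*2 < j < p + n & getb x j.
  case/and5P: hev => _ nsw _ _ _.
  case: (boolP [exists j : 'I_(p + n), (p + s.*2 < j) && getb x j]).
    by move=> /existsP[j /andP[hj1 hj2]]; exists j => //; rewrite hj1 /=.
  rewrite negb_exists => /forallP hno; case/negP: nsw.
  apply: (@sword_of_block n k k2n x p s xX); first by slia.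
  move=> j hj; case: (leqP j (p + s)) => hjs; first by apply: h2; slia.
  case: (leqP j (p + s.*2)) => hjs2; first by apply: h3; slia.
  case: (j =P p + n) => [->|hjn]; first by rewrite getbDn h1.
  have hjpn : j < p + n by slia.
  by have := hno (Ordinal hjpn); rewrite /= hjs2 /= => /negbTE.
have ex : exists l, getb x l && (l < p + n) by exists j; rewrite hj2; case/andP: hj1.
have ub l : getb x l && (l < p + n) -> l <= p + n by case/andP => _; slia.
case: (ex_maxnP ex ub) => l /andP[hl1 hl2] hm.
have jl : j <= l by apply: hm; rewrite hj2; case/andP: hj1.
have hl3 : ~~ getb x l.+1.
  apply/negP => hh; case: (l.+1 =P p + n) => e.
    by move: hh; rewrite e getbDn h1.
  by have := hm l.+1; rewrite hh /=; slia.
have hload := longruns_load lx hs hl1 hl3.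
have hmax := load_le_max l.+1 lx.
have el : load x l.+1 = maxload x by slia.
exists l.+1 => //; case: (l.+1 =P p + n) => e; last by slia.
by move: el; rewrite e loadDn // (load_free fp); have := maxload_gt0; slia.
Qed.

Lemma peakP : p + s.*2 < P < p + n /\ load x P = maxload x.
Proof.
have [i hi ei] := peak_exists.
have hi' : i < p + n by case/andP: hi.
have [/eqP h1 h2 _] : [/\ load x P == maxload x, i <= P < p + n & _] :=
  @last_beforeP (fun i => load x i == maxload x) _ _ hi' (introT eqP ei).
by split => //; slia.
Qed.

(** The load of the core is positive at the peak, which therefore lies strictly inside a gap of the
    core. As the low gap is itself a gap, this one equals it or ends no later than its start. *)
Lemma highgap_gap : exists G', [/\ gap T G G', p + s.*2 <= G, G < P < G' & G' <= a + n \/ G = a + n].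
Proof.
have [hP eP] := peakP.
have hP' : p + s.*2 < P by case/andP: hP.
have [h1 h2 h3] : [/\ free T G, p + s.*2 <= G < P & forall j, G < j < P -> ~~ free T j].
  exact: last_beforeP hP' core_free_end.
have lTP : load T P = maxload x by rewrite load_core ?eP; slia.
have nfP : ~~ free T P.
  by apply/negP => /load_free; rewrite lTP; have := maxload_gt0; slia.
have Gpn : G < p + n by slia.
have [G' hg hG'] := next_gap h1 Gpn core_free_p.
exists G'; have [g1 g2 g3 g4] := hg; have [l1 l2 l3 l4] := lowgap_gapn.
have PG' : P < G'.
  rewrite ltnNge; apply/negP; rewrite leq_eqVlt => /orP[/eqP e|h].
    by rewrite e (negbTE nfP) in g2.
  by have := h3 G'; rewrite g2; slia.
split => //; try slia.
case: (ltngtP G (a + n)) => h; [left | | by right].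
  rewrite leqNgt; apply/negP => h'; have := g4 (a + n); rewrite l1; slia.
by have := l4 G; rewrite h1 h Gpn => /(_ isT).
Qed.


Lemma slot_core : slot T p s /\ getb T (p + s.*2) = false.
Proof.
have [h1 h2 h3] := event_bits.
split; last by rewrite getb_core ?h3; slia.
split.
- by rewrite (getb_free core_free_p0).
- exact: getb_core_p1.
- by move=> i hi; rewrite getb_core ?h2; slia.
- by move=> i hi; rewrite getb_core ?h3; slia.
- split=> i hi.
    by rewrite load_core ?event_load_up; slia.
  by rewrite load_core ?event_load_down; slia.
Qed.

Lemma fill_facts g : ~~ getb T g -> [/\ inX k (setbit T g true), light (setbit T g true)
  & setbit (setbit (setbit T g true) g false) p.+1 true = x].
Proof.
move=> hg; have [_ h1 h2] := light_setbit count_core k2n hg; split => //.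
by rewrite setbit_setbit // (@setbit_K _ T g false) ?core_xK //; apply/negbTE.
Qed.

Lemma connector_xy : connector k x y.
Proof.
have hb := lowgap_bounds.
have [_ hg] := lowgap_gap.
rewrite -core_xK /y /ylow -/T -/a -(@setbit_eqmod _ T (a + n) a); last by rewrite modnDr.
apply: connector_gaps count_core k2n core_block_gap lowgap_gapn _ _; slia.
Qed.

Lemma ylow_load : [/\ forall i, a <= i <= a + n -> load y i = load T i + (a < i <= p)
  & forall i, a < i < a + n -> getb y i = getb T i].
Proof.
have [hg _] := lowgap_gap; have [f1 _ _ _] := hg.
have [_ ly _] := fill_facts (negbT (getb_free f1)).
have hb := lowgap_bounds.
split; first by move=> i hi; apply: load_fill => //; slia.
by move=> i hi; apply: getb_fill.
Qed.

Lemma ylow_slotted : slotted k x p s y (a + n).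
Proof.
have [hg _] := lowgap_gap; have [f1 f2 ap _] := hg.
have [Xy ly ex] := fill_facts (negbT (getb_free f1)).
have hb := lowgap_bounds; have [f3 _ hf3] := third_zero.
have [hload hbit] := ylow_load.
have [[s1 s2 s3 s4 [s5 s6]] s7] := slot_core.
split => //.
- split; rewrite ?hbit //; try slia.
  + by move=> i hi; rewrite hbit ?s3 //; slia.
  + by move=> i hi; rewrite hbit ?s4 //; slia.
  + split=> i hi.
      by rewrite hload ?s5 //; slia.
    by rewrite hload ?s6 //; slia.
- by rewrite hbit ?s7; slia.
- split; [slia | | | slia].
    by rewrite getbDn /y /ylow getb_fill0.
  by rewrite loadDn // hload ?(load_free f1) //; slia.
- by rewrite (@setbit_eqmod _ _ (a + n) a) ?modnDr.
Qed.

(** This tells [ylow] from [uhigh], whose load at [p] is 0. *)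
Lemma ylow_load_p : load y p = 1.
Proof.
have [[f1 f2 ap _] _] := lowgap_gap; have [hload _] := ylow_load; have hb := lowgap_bounds.
by rewrite hload ?(load_free f2) //; slia.
Qed.

(** Once [p] is known, the moved one is found as the last position before [p] with load 0. *)
Lemma ylow_lowgap : [/\ a < p < a + n, load y a = 0 & forall i, a < i <= p -> 0 < load y i].
Proof.
have [[f1 f2 ap _] _] := lowgap_gap; have [hload _] := ylow_load; have hb := lowgap_bounds.
split; first by slia.
  by rewrite hload ?(load_free f1) //; slia.
by move=> i hi; rewrite hload; slia.
Qed.

Lemma maxload_core_le i : load T i <= maxload x.
Proof.
have [j hj e] := lift_window i p.+1 n0.
rewrite -(load_eqmod lT e) load_core; last by slia.
by have := load_le_max j lx; slia.
Qed.

Lemma load_core_peak : load T P = maxload x.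
Proof. by have [hP <-] := peakP; rewrite load_core; slia. Qed.

Lemma maxload_ylow : maxload x <= maxload y.
Proof.
have [hg _] := lowgap_gap; have [f1 f2 ap _] := hg.
have [_ ly _] := fill_facts (negbT (getb_free f1)).
have hb := lowgap_bounds.
rewrite -load_core_peak; apply: leq_trans (load_le_max P ly).
by apply: load_fill_ge hg _ => //; slia.
Qed.

Lemma uhigh_load G' : gap T G G' -> G' <= p + n -> p + s.*2 <= G ->
  [/\ forall i, G <= i <= G + n -> load u i = load T i + (G < i <= G')
  & forall i, G < i < G + n -> getb u i = getb T i].
Proof.
move=> hg hG' hG; have [f1 _ _ _] := hg.
have [_ lu _] := fill_facts (negbT (getb_free f1)).
split; first by move=> i hi; apply: load_fill => //; slia.
by move=> i hi; apply: getb_fill.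
Qed.

Lemma maxload_uhigh : maxload u = (maxload x).+1 /\ load u P = (maxload x).+1.
Proof.
have [G' [hg h1 h2 h3]] := highgap_gap; have [f1 f2 _ _] := hg.
have [_ lu _] := fill_facts (negbT (getb_free f1)).
have hb := lowgap_bounds; have [hP _] := peakP.
have G'pn : G' <= p + n.
  have [_ _ _ g4] := hg; rewrite leqNgt; apply/negP => h.
  by have := g4 (p + n); rewrite core_free_p; slia.
have [hload _] := uhigh_load hg G'pn h1.
have eP : load u P = (maxload x).+1 by rewrite hload ?load_core_peak; slia.
split => //; apply/eqP; rewrite eqn_leq; apply/andP; split.
  apply/bigmax_leqP => i _; have [j hj e] := lift_window i G n0.
  rewrite -(load_eqmod lu e) hload; last by slia.
  by have := maxload_core_le j; slia.
by rewrite -eP load_le_max.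
Qed.

(** Otherwise [uhigh] and [ylow] would coincide, but the former has a larger maximal load. *)
Lemma highgap_neq : maxload y = maxload x -> G <> a + n.
Proof.
move=> hm eG; have [hu _] := maxload_uhigh.
have : u = y by rewrite /u /uhigh -/T -/G eG (@setbit_eqmod _ T (a + n) a) ?modnDr.
by move=> e; rewrite e hm in hu; move: hu; slia.
Qed.

Hypothesis hm : maxload y = maxload x.

Lemma highgap_gap_low : exists G', [/\ gap T G G', p + s.*2 <= G, G < P < G' & G' <= a + n].
Proof.
have [G' [h1 h2 h3 [h4|h4]]] := highgap_gap; first by exists G'.
by case: (highgap_neq hm).
Qed.

Lemma uhigh_slotted : slotted k x p s u G.
Proof.
have [G' [hg hG hP hG']] := highgap_gap_low; have [f1 f2 GG' gg] := hg.
have [Xu lu ex] := fill_facts (negbT (getb_free f1)).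
have hb := lowgap_bounds; have G'pn : G' <= p + n by slia.
have [hload hbit] := uhigh_load hg G'pn hG.
have [[s1 s2 s3 s4 [s5 s6]] s7] := slot_core.
have hload' i : p < i <= p + s.*2 -> load u i = load T i.
  move=> hi; rewrite -(loadDn i lu) -(loadDn i lT) hload; last by slia.
  by slia.
have hbit' i : p <= i < p + s.*2 -> getb u i = getb T i.
  by move=> hi; rewrite -(getbDn u) -(getbDn T) hbit //; slia.
have uG : getb u G by rewrite /u /uhigh getb_fill0.
split => //.
- split; rewrite ?hbit' //; try slia.
  + by move=> i hi; rewrite hbit' ?s3 //; slia.
  + by move=> i hi; rewrite hbit' ?s4 //; slia.
  + split=> i hi.
      by rewrite hload' ?s5 //; slia.
    by rewrite hload' ?s6 //; slia.
- case: eqP => [<- //|e].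
  by rewrite -(getbDn u) hbit ?getbDn ?s7 //; slia.
- split => //; first by slia.
    by rewrite hload ?(load_free f1) //; slia.
  move=> _; rewrite hbit; last by slia.
  have := gg G.+1; rewrite /free (load_freeS f1) andbT negbK; apply; slia.
Qed.

Lemma uhigh_load_p : load u p = 0.
Proof.
have [G' [hg hG hP hG']] := highgap_gap_low; have [f1 f2 GG' gg] := hg.
have [Xu lu ex] := fill_facts (negbT (getb_free f1)).
have hb := lowgap_bounds; have G'pn : G' <= p + n by slia.
have [hload hbit] := uhigh_load hg G'pn hG.
by rewrite -(loadDn p lu) hload ?(load_free core_free_p); slia.
Qed.

(** Once [p] is known, any load maximum of [u] locates the filled gap, and the moved one is the last
    position of load 0 before it. *)
Lemma uhigh_top : exists G', [/\ G < P < G', G' < p + n,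
  forall i, G < i <= G' -> 0 < load u i, load u P = maxload u
  & forall i, p <= i < p + n -> load u i = maxload u -> G < i <= G'].
Proof.
have [G' [hg hG hP hG']] := highgap_gap_low; have [f1 f2 GG' gg] := hg.
have [Xu lu ex] := fill_facts (negbT (getb_free f1)).
have hb := lowgap_bounds; have G'pn : G' <= p + n by slia.
have [hload hbit] := uhigh_load hg G'pn hG.
have [mu mP] := maxload_uhigh.
exists G'; split => //; try slia.
  by move=> i hi; rewrite hload; slia.
move=> i hi ei; case: (leqP G i) => h.
  by move: ei; rewrite mu hload; have := maxload_core_le i; slia.
move: ei; rewrite mu -(loadDn i lu) hload; last by slia.
by have := maxload_core_le (i + n); slia.
Qed.

(** [connector_gaps] needs gaps without a common end. The gap of the block ends at [p + s.*2]; if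
    the high gap starts there, it is paired with the low gap instead, and the third zero keeps these
    two apart. *)
Lemma connector_exit : if G == p + s.*2 then connector k u y else connector k x u.
Proof.
have [G' [hg hG hP hG']] := highgap_gap_low; have [f1 f2 GG' gg] := hg.
have hb := lowgap_bounds; have [f3 ff3 hf3] := third_zero.
case: eqP => e.
  rewrite /y /ylow -/T -/a -(@setbit_eqmod _ T (a + n) a); last by rewrite modnDr.
  apply: connector_gaps count_core k2n hg lowgap_gapn _ _; last by slia.
  have : G' <= f3.
    by rewrite leqNgt; apply/negP => h; have := gg f3; rewrite ff3; slia.
  by slia.
rewrite -core_xK; apply: connector_gaps count_core k2n core_block_gap hg _ _; slia.
Qed.

End Event.

(** * Parity of the minimal run length *)

Section Parity.
Variable n : nat.
Implicit Types x y : bstr n.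

(** Only four runs change, each by one position: the ones from [q.+1] on and the zeros up to [a.+1]
    shrink, the zeros before [q.+1] and the ones after [a.+1] grow. *)
Lemma longruns_move x s a q : 0 < n -> longruns s x -> 1 < s ->
  getb x a = false -> getb x a.+1 = false -> getb x a.+2 ->
  getb x q = false -> getb x q.+1 -> (forall i, q.+1 < i <= q + s -> getb x i) ->
  a.+1 <> q %[mod n] ->
  longruns s.-1 (setbit (setbit x q.+1 false) a.+1 true).
Proof.
move=> n0 hs s1 xa xa1 xa2 xq xq1 xq2 naq.
set y := setbit _ _ _.
have yE i : getb y i = if i %% n == a.+1 %% n then true
    else if i %% n == q.+1 %% n then false else getb x i.
  by rewrite /y !getb_setbit.
have tr (z : bstr n) i j l : i = j %[mod n] -> getb z (i + l) = getb z (j + l).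
  by move=> e; apply: getb_eqmod; rewrite -modnDml e modnDml.
have trS (z : bstr n) i j : i = j %[mod n] -> getb z i.+1 = getb z j.+1.
  by move=> /(tr z _ _ 1); rewrite !addn1.
have pred i j : i.+1 = j.+1 %[mod n] -> i = j %[mod n].
  by move=> /eqP; rewrite -addn1 -[j.+1]addn1 eqn_modDr => /eqP.
have A0 i : i = a.+1 %[mod n] -> getb x i = false /\ getb x i.+1 /\ getb y i.+1.
  move=> e; rewrite (getb_eqmod x e) (trS x _ _ e) xa2; do 2!split => //.
  rewrite yE; case: eqP => // _; case: eqP => [e'|_]; last by rewrite (trS x _ _ e).
  by case: naq; rewrite -e; apply: pred.
have A1 i : i.+1 = a.+1 %[mod n] -> getb x i = false.
  by move=> /pred e; rewrite (getb_eqmod x e).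
have Q0 i : i = q.+1 %[mod n] -> getb x i /\ (forall l, 0 < l < s -> getb x (i + l)).
  move=> e; rewrite (getb_eqmod x e) xq1; split => // l hl.
  by rewrite (tr x _ _ l e); apply: xq2; slia.
have Q1 i : i.+1 = q.+1 %[mod n] -> getb x i = false /\ getb y i = false.
  move=> /pred e; rewrite (getb_eqmod x e) xq; split => //; rewrite yE.
  case: eqP => [e'|_]; first by case: naq; rewrite -e' -e.
  by case: eqP => // _; rewrite (getb_eqmod x e).
have yx i : i <> a.+1 %[mod n] -> i <> q.+1 %[mod n] -> getb y i = getb x i.
  by move=> h1 h2; rewrite yE; case: eqP => //; case: eqP.
have naq' i : i = a.+1 %[mod n] -> i <> q.+1 %[mod n].
  by move=> e e'; have [h _] := A0 _ e; have [h' _] := Q0 _ e'; rewrite h in h'.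
have ya i : i = a.+1 %[mod n] -> getb y i.
  by move=> e; rewrite yE; case: eqP.
have yq i : i = q.+1 %[mod n] -> getb y i = false.
  move=> e; rewrite yE; case: eqP => [/naq' //|_]; by case: eqP.
have y1 i : getb y i -> getb x i \/ i = a.+1 %[mod n].
  by rewrite yE; case: eqP; [right | case: eqP => // _ _; left].
have y0 i : getb y i = false -> getb x i = false \/ i = q.+1 %[mod n].
  by rewrite yE; case: eqP => // _; case: eqP; [right | left].
have A2 i : i.+1 = a.+1 %[mod n] -> getb x i = false /\ getb y i = false.
  move=> ei; have h := A1 _ ei; split => //; apply/negP => /y1 [h'|/A0 [_ [h' _]]].
    by rewrite h in h'.
  by have [h2 _] := A0 _ ei; rewrite h2 in h'.
have Q3 i l : i = q.+1 %[mod n] -> 0 < l < s -> getb y (i + l).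
  move=> ei hl; have [h1 h2] := Q0 _ ei.
  rewrite yx ?h2 // => [/A0 [h _]|eq]; first by rewrite h2 in h.
  have hl1 : 0 < l by case/andP: hl.
  have := Q1 (i + l).-1; rewrite prednK; last by rewrite addn_gt0 hl1 orbT.
  case/(_ eq) => h _; move: h; rewrite -subn1 -addnBA // subn1.
  case: l hl hl1 eq => // [[|l]] hl _ _ /=; first by rewrite addn0 h1.
  by rewrite h2 //; slia.
have bad b c l : 0 < l < s -> getb x c = ~~ b -> (forall i, c < i <= c + l -> getb x i = b) ->
    getb x (c + l).+1 = ~~ b -> False.
  move=> hl h1 h2 h3; have := @longruns_xrun n s x b c l n0 hs.
  have -> : xrun x b c l by apply/xrunP.
  by slia.
apply/longrunsP => // i j0 hi hj0; apply/eqP/negPn/negP => hne.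
have ex : exists j, getb y (i.+1 + j) != getb y i.+1 by exists j0.
(* The first change after [i] ends a run of [y] of length [j < s.-1]. Up to one position at one of
   its ends this is a run of [x], of length below [s]. *)
case: (ex_minnP ex) => j hj hm.
have jj0 := hm _ hne.
have hrun l : l < j -> getb y (i.+1 + l) = getb y i.+1.
  by move=> hl; apply/eqP/negPn/negP => h; have := hm _ h; slia.
have j1 : 0 < j by case: (j) hj => //; rewrite addn0 eqxx.
have js : j < s.-1 by slia.
have run l : i < l <= i + j -> getb y l = getb y i.+1.
  by move=> hl; rewrite -(hrun (l - i.+1)); [congr getb; slia | slia].
have yend : getb y (i + j).+1 = ~~ getb y i.+1.
  by move: hj; rewrite addSn; case: getb; case: getb.
have ybeg : getb y i = ~~ getb y i.+1 by move: hi; case: getb; case: getb.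
clear hi hj hne hm ex jj0 hj0 j0 hrun.
case e: (getb y i.+1) in run yend ybeg.
- have xend : getb x (i + j).+1 = false.
    by case: (y0 _ yend) => // /Q1 [_ h]; rewrite run in h; slia.
  have xbeg : getb x i = false.
    case: (y0 _ ybeg) => // hQ; have := Q3 i j.+1 hQ ltac:(slia).
    by rewrite addnS yend.
  have xrest l : i.+1 < l <= i + j -> getb x l.
    move=> hl; case: (y1 l); rewrite ?run //; first by slia.
    move=> el; have := A2 l.-1; rewrite prednK; last by slia.
    by case/(_ el) => _; rewrite run //; slia.
  case: (i.+1 %% n =P a.+1 %% n) => ea.
    have [h1 [h2 h3]] := A0 _ ea.
    have j2 : 1 < j.
      by rewrite ltnNge; apply/negP => hj; move: yend; rewrite (_ : j = 1) ?addn1 ?h3 //; slia.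
    apply: (bad true i.+1 j.-1) => //; first by slia.
      by move=> l hl; apply: xrest; slia.
    by rewrite (_ : i.+1 + j.-1 = i + j) ?xend //; slia.
  apply: (bad true i j) => //; first by slia.
  move=> l hl; case: (l =P i.+1) => [->|hl']; last by apply: xrest; slia.
  by case: (y1 i.+1) => //; rewrite ?run //; slia.
have xbeg : getb x i.
  by case: (y1 _ ybeg) => // /A0 [_ [_]]; rewrite e.
have noQ l : i < l < i + j -> l <> q.+1 %[mod n].
  by move=> hl hQ; have := Q3 l 1 hQ s1; rewrite addn1 run //; slia.
have xz l : i < l < i + j -> getb x l = false.
  by move=> hl; case: (y0 l) => [|//|/noQ]; [rewrite run //; slia | case].
case: ((i + j).+1 %% n =P a.+1 %% n) => ea.
  have [h1 [h2 h3]] := A0 _ ea.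
  have xj : getb x (i + j) = false.
    case: (y0 (i + j)) => [|//|/Q0 [_ h]]; first by rewrite run //; slia.
    by have := h 1 s1; rewrite addn1 h1.
  apply: (bad false i j.+1) => //; first by slia.
    move=> l hl; case: (ltngtP l (i + j)) => h; first by apply: xz; slia.
      by rewrite (_ : l = (i + j).+1) //; slia.
    by rewrite h.
  by rewrite addnS h2.
have xend : getb x (i + j).+1 by case: (y1 _ yend).
case: ((i + j) %% n =P q.+1 %% n) => eq.
  have [h1 _] := Q0 _ eq.
  have j2 : 1 < j.
    rewrite ltnNge; apply/negP => hj; have ej : j = 1 by slia.
    by move: eq; rewrite ej addn1 => /Q1 [h _]; rewrite h in xbeg.
  apply: (bad false i j.-1) => //; first by slia.
    by move=> l hl; apply: xz; slia.
  by rewrite (_ : (i + j.-1).+1 = i + j) ?h1 //; slia.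
apply: (bad false i j) => //; first by slia.
move=> l hl; case: (ltngtP l (i + j)) => h; [by apply: xz; slia | by slia |].
by rewrite h; case: (y0 (i + j)) => //; rewrite run //; slia.
Qed.

End Parity.

Ltac slia ::=
  repeat match goal with
  | H : forall _, _ |- _ => clear H
  | H : is_true (free _ _) |- _ => clear H
  | H : is_true (~~ free _ _) |- _ => clear H
  | H : is_true (getb _ _) |- _ => clear H
  | H : is_true (~~ getb _ _) |- _ => clear H
  | H : is_true (light _) |- _ => clear H
  | H : is_true (inX _ _) |- _ => clear H
  | H : is_true (event _ _ _ _) |- _ => clear H
  | H : is_true (longruns _ _) |- _ => clear H
  | H : is_true (xrun _ _ _ _) |- _ => clear H
  | H : getb _ _ = _ |- _ => clear H
  | H : @eq (bstr _) _ _ |- _ => clear H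
  | H : _ %% _ = _ %% _ |- _ => clear H
  | H : _ %% _ <> _ %% _ |- _ => clear H
  | H := _ |- _ => try unfold H in *; clearbody H
  end; lia.

Section Successor.
Variables (n k : nat).
Hypothesis k3n : k.*2 + 3 <= n.
Implicit Types x v : bstr n.

(** If the low gap starts right below [p], the moved one is isolated there and forms a run of length
    1. Otherwise it is glued to the run of ones starting at [a.+1], and the rest of the block is a
    run of length [s.-1]. Both lengths are odd. *)
Lemma parity_step x p s : event k x p s -> n <= p -> ~~ odd s ->
  exists s' b c, [/\ odd s', longruns s' (ylow x p) & xrun (ylow x p) b c s'].
Proof.
move=> hev np os; have n0 : 0 < n by slia.
have lx := event_light k3n hev np; have s0 := event_s0 hev; have sk := event_sk hev.
have s2 : 1 < s by case: (s) os s0 => [|[]].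
have [[f1 f2 ap hg] pna] := lowgap_gap k3n hev np.
have hb := lowgap_bounds k3n hev np.
have [hload hbit] := ylow_load k3n hev np.
have [b1 b2 b3] := event_bits k3n hev np.
have lT := light_core k3n hev np.
have [_ [v0 v1 v2 v3 _] _ [_ yan _ _] _] := ylow_slotted k3n hev np.
have gT i : p.+1 < i <= p + n -> getb (core x p) i = getb x i by apply: (getb_core k3n hev np).
set a := lowgap x p in f1 ap hg pna hb hload hbit yan *.
have xa : getb x (a + n) = false by rewrite -gT ?getbDn ?(getb_free f1) //; slia.
have la : load x (a + n) = 0.
  have := load_core k3n hev np (i := a + n); rewrite loadDn // (load_free f1) => /(_ ltac:(slia)).
  by slia.
have xa1 : getb x (a + n).-1 = false.
  apply/negP => h; have := loadS x (a + n).-1; rewrite h prednK; last by slia.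
  by rewrite la.
case: (ltngtP a p.-1) => ea; last 1 first.
- exists 1, true, (a + n).-1; split => //; first exact: longruns1.
  have e1 : (a + n).-1.+1 = a + n by slia.
  apply/xrunP; split.
  + by rewrite hbit ?gT ?xa1 //; slia.
  + by move=> i hi; rewrite (_ : i = a + n) //; slia.
  + by rewrite addn1 e1 (_ : (a + n).+1 = p + n) ?getbDn ?v0 //; slia.
- have xa2 : getb x (a + n).+1.
    rewrite -gT; last by slia.
    rewrite -addSn getbDn; have := hg a.+1 ltac:(slia).
    by rewrite /free (load_freeS f1) andbT negbK.
  exists s.-1, true, p.+1; split.
  + by case: (s) os s2 => //= m; rewrite negbK.
  + rewrite /ylow -/a -(@setbit_eqmod _ _ (a + n) a) ?modnDr // /core.
    have e1 : (a + n).-1.+1 = a + n by slia.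
    rewrite -{1}e1; apply: (longruns_move n0 (event_longruns hev) s2 xa1).
    * by rewrite e1.
    * by rewrite e1.
    * exact: b1.
    * by apply: b2; slia.
    * by move=> i hi; apply: b2; slia.
    * rewrite e1 => /eqmod_window h; have : a + n = p by apply: h; slia.
      by slia.
  + apply/xrunP; split => //.
      by move=> i hi; apply: v2; slia.
    by rewrite v3 //; slia.
- by slia.
Qed.

End Successor.

(** * Decoding a vertex from its window *)

Section Decoding.
Variables (n k : nat).
Hypothesis k3n : k.*2 + 3 <= n.
Implicit Types x v : bstr n.

Lemma last_run_unique (v : nat -> bool) a b a' b' c :
  v a = false -> v a' = false -> a < b <= c -> a' < b' <= c ->
  (forall i, a < i <= b -> v i) -> (forall i, a' < i <= b' -> v i) ->
  (forall i, b < i <= c -> v i = false) -> (forall i, b' < i <= c -> v i = false) ->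
  a = a' /\ b = b'.
Proof.
move=> va va' hb hb' h1 h1' h2 h2'.
have eb : b = b'.
  case: (ltngtP b b') => // h.
    by have := h2 b' ltac:(slia); rewrite h1' //; slia.
  by have := h2' b ltac:(slia); rewrite h1 //; slia.
split => //; case: (ltngtP a a') => // h.
  by have := h1 a' ltac:(slia); rewrite va'.
by have := h1' a ltac:(slia); rewrite va.
Qed.

Lemma run_around_unique (v : nat -> bool) a b a' b' c :
  v a = false -> v a' = false -> v b.+1 = false -> v b'.+1 = false ->
  a < c <= b -> a' < c <= b' ->
  (forall i, a < i <= b -> v i) -> (forall i, a' < i <= b' -> v i) ->
  a = a' /\ b = b'.
Proof.
move=> va va' vb vb' hb hb' h1 h1'; split.
  case: (ltngtP a a') => // h.
    by have := h1 a' ltac:(slia); rewrite va'.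
  by have := h1' a ltac:(slia); rewrite va.
case: (ltngtP b b') => // h.
  by have := h1' b.+1 ltac:(slia); rewrite vb.
by have := h1 b'.+1 ltac:(slia); rewrite vb'.
Qed.

(* [s] consecutive values of [p]: [B] lies in the run of ones following [p] if [s]
   is even, and in the [s] zeros after that run if [s] is odd. *)
Definition window s p B := if odd s then p + s < B <= p + s.*2 else p < B <= p + s.

(* In the surviving case, [x2] contributes its vertex [uhigh x2 p2]. *)
Lemma event_slotted_clash x p s x2 p2 s2 g2 B :
  event k x p s -> n <= p -> window s p B ->
  0 < s2 -> slotted k x2 p2 s2 x g2 -> window s2 p2 B ->
  [/\ s2 = 1, g2 = p2.+2 & p = p2.+1].
Proof.
move=> hev np hw s20 [_ [v0 v1 v2 v3 [l1 l2]] vend [hg2 vg lg _] _] hw2.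
have s0 := event_s0 hev.
have [b1 b2 b3] := event_bits k3n hev np.
have u1 := event_load_up k3n hev np; have u2 := event_load_down k3n hev np.
have fp := event_free hev.
move: hw hw2; rewrite /window; case: ifP => os; case: ifP => os2 hw hw2.
- have lB : 0 < load x B by rewrite u2; slia.
  have vB : getb x B = false by rewrite b3.
  have B2 : B < p2 + s2.*2.
    by rewrite ltnNge; apply/negP => h; move: lB; rewrite (_ : B = p2 + s2.*2) ?l2; slia.
  have s21 : 1 < s2 by slia.
  have [] := @last_run_unique (getb x) p (p + s) p2.+1 (p2 + s2) B => //; try slia.
  + by move=> i hi; apply: b3; slia.
  + by move=> i hi; apply: v3; slia.
- have lB : 0 < load x B by rewrite u2; slia.
  have vB : getb x B = false by rewrite b3.
  case: (B =P p2.+1) => eB; first by move: lB; rewrite eB l1; slia.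
  by move: vB; rewrite v2 //; slia.
(* A one in the window of an odd slot can only be the moved one, at the end of the slot. *)
- have vB : getb x B by apply: b2.
  have [eB eg] : B = p2 + s2.*2 /\ g2 = B.
    case: (ltngtP B (p2 + s2.*2)) => h; [by move: vB; rewrite v3 //; slia | by slia |].
    by split => //; move: vB; rewrite h vend => /eqP.
  have vB1 : getb x B.-1 = false.
    case: (s2 =P 1) => e1; last by apply: v3; slia.
    by rewrite (_ : B.-1 = p2.+1) //; slia.
  have ep : p = B.-1.
    case: (ltngtP p B.-1) => // h; last by slia.
    by have := b2 B.-1 ltac:(slia); rewrite vB1.
  case: (s2 =P 1) => e1; first by split => //; slia.
  by move: (load_free fp); rewrite ep l2; slia.
have vB : getb x B by apply: b2.
have B2 : p2.+1 < B.
  by case: (ltngtP p2.+1 B) => // h; [slia | by move: vB; rewrite -h v1].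
have s21 : 1 < s2 by slia.
have [] := @run_around_unique (getb x) p (p + s) p2.+1 (p2 + s2) B => //; try slia.
  by apply: b3; slia.
by apply: v3; slia.
Qed.

(** For even lengths, a zero at [B] means that [B] is [p.+1], and a one that [B] lies in the run
    starting at [p.+2]. For odd lengths, [B.-1] is free exactly if the length is 1, the load at [B]
    vanishes exactly at the end of the slot, and [p] is read off the last run of ones before [B]. *)
Lemma slotted_slotted x1 p1 s1 g1 x2 p2 s2 g2 v B : 0 < s1 -> 0 < s2 ->
  slotted k x1 p1 s1 v g1 -> slotted k x2 p2 s2 v g2 -> odd s1 = odd s2 ->
  window s1 p1 B -> window s2 p2 B -> p1 = p2.
Proof.
move=> s10 s20 h1 h2 os; rewrite /window os; case: ifP => os2 w1 w2; last first.
  have ev x p s g : 1 < s -> slotted k x p s v g -> p < B <= p + s -> getb v B = (p.+1 < B).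
    move=> s0 [_ [y0 y1 y2 y3 _] _ _ _] hB.
    by case: ltngtP => h; [rewrite y2; slia | slia | rewrite -h y1].
  have s11 : 1 < s1 by slia.
  have s21 : 1 < s2 by slia.
  have e1 := ev _ _ _ _ s11 h1 w1; have e2 := ev _ _ _ _ s21 h2 w2.
  case eB : (getb v B) in e1 e2; last by slia.
  case: h1 h2 => [_ [y0 y1 y2 y3 _] _ _ _] [_ [z0 z1 z2 z3 _] _ _ _].
  have [] := @run_around_unique (getb v) p1.+1 (p1 + s1) p2.+1 (p2 + s2) B => //; try slia.
    by apply: y3; slia.
  by apply: z3; slia.
have fr x p s g : 0 < s -> slotted k x p s v g -> p + s < B <= p + s.*2 ->
    free v B.-1 = (s == 1).
  move=> s0 [_ [y0 y1 y2 y3 [n1 n2]] _ _ _] hB; rewrite /free.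
  case: (s =P 1) => es; first by rewrite (_ : B.-1 = p.+1) ?y1 ?n1; slia.
  case: (ltnP (p + s) B.-1) => h; last by rewrite y2 //; slia.
  by rewrite n2; slia.
have ls x p s g : 0 < s -> slotted k x p s v g -> p + s < B <= p + s.*2 ->
    (load v B == 0) = (B == p + s.*2).
  by move=> s0 [_ [y0 y1 y2 y3 [n1 n2]] _ _ _] hB; rewrite n2; slia.
have := fr _ _ _ _ s20 h2 w2; rewrite (fr _ _ _ _ s10 h1 w1) => ef.
have := ls _ _ _ _ s20 h2 w2; rewrite (ls _ _ _ _ s10 h1 w1) => el.
clear fr ls os os2.
case: h1 h2 => [_ [y0 y1 y2 y3 _] _ _ _] [_ [z0 z1 z2 z3 _] _ _ _].
case: (s1 =P 1) ef => e1 ef; first by slia.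
have [c [c1 c2]] : exists c, p1 + s1 <= c < p1 + s1.*2 /\ p2 + s2 <= c < p2 + s2.*2.
  (* At the end of the slot the bit may be the moved one, so the zeros are then read up to [B.-1]
     only. *)
  exists (if B == p1 + s1.*2 then B.-1 else B); move: el.
  by case: eqP => e2 el; split; slia.
have z i : p1 + s1 < i <= c -> getb v i = false by move=> hi; apply: y3; slia.
have z' i : p2 + s2 < i <= c -> getb v i = false by move=> hi; apply: z3; slia.
have q1 : p1.+1 < p1 + s1 <= c by slia.
have q2 : p2.+1 < p2 + s2 <= c by slia.
by have [[//]] := last_run_unique y1 z1 q1 q2 y2 z2 z z'.
Qed.

(* The configuration in which an even slot ending at [B] meets an odd slot
   starting there; it violates the run-length bounds of [x1] and [x2]. *)
Lemma even_odd_clash x1 p1 s1 x2 p2 s2 g2 v a :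
  event k x1 p1 s1 -> event k x2 p2 s2 -> n <= p1 -> n <= p2 ->
  1 < s1 -> 2 < s2 -> p1.+1 = p2 + s2.*2 ->
  slotted k x1 p1 s1 v (a + n) -> slotted k x2 p2 s2 v g2 ->
  getb v p1.+1 = false -> a < p1 < a + n -> load v a = 0 ->
  (forall i, a < i <= p1 -> 0 < load v i) -> False.
Proof.
move=> hev1 hev2 np1 np2 s11 s21 eB h1 h2 vB ha la hpos.
have n0 : 0 < n by slia.
have sk1 := event_sk hev1; have sk2 := event_sk hev2.
have lr1 := event_longruns hev1; have lr2 := event_longruns hev2.
case: h1 h2 => [_ [y0 y1 y2 y3 [n1 n2]] _ _ ex1] [Xv [z0 z1 z2 z3 [m1 m2]] _ [hg vg lg hg1] ex2].
have lv : light v by apply: inX_light Xv; slia.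
have ea : a = p2.+2.
  case: (ltngtP a p2.+2) => // h.
    by have := hpos p2.+2; rewrite m1; slia.
  move: la; case: (leqP a (p2 + s2).+1) => h'; first by rewrite m1; slia.
  by rewrite m2; slia.
have bx1 i : p2.+1 < i < p1 -> getb x1 i = if i == p2.+2 then false else getb v i.
  move=> hi; rewrite ex1 getb_setbit // modn_window_eq; try slia.
  rewrite (_ : (i == p1.+1) = false); last by slia.
  rewrite getb_setbit // ea modnDr modn_window_eq //; slia.
(* In [x1] the one at [a = p2.+2] is taken back, which leaves a run of [s2.-2] ones; hence
   [s1 <= s2.-2]. *)
have r1 : xrun x1 true p2.+2 s2.-2.
  apply/xrunP; split.
  - by rewrite bx1 ?eqxx //; slia.
  - move=> i hi; rewrite bx1; last by slia.
    by case: eqP => e; [slia | apply: z2; slia].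
  - rewrite bx1; last by slia.
    by case: eqP => e //; apply: z3; slia.
have ss := longruns_xrun n0 lr1 (_ : 0 < s2.-2) r1; have {}ss : s1 <= s2.-2 by apply: ss; slia.
set B := p1.+1 in eB vB.
have bv2 i : B < i < B + s1 -> getb v i by move=> hi; apply: y2; slia.
have bv3 : getb v (B + s1) = false.
  by rewrite (_ : B + s1 = (p1 + s1).+1) ?y3 //; slia.
have lv2 i : B <= i <= B + s1 -> load v i = i - B.-1.+2.
  by move=> hi; rewrite n1; slia.
have bx2 i : B <= i <= B + s1 -> getb x2 i = if i %% n == g2 %% n then false else getb v i.
  move=> hi; rewrite ex2 !getb_setbit //; case: eqP => [e|//].
  have := load_eqmod lv e; have := getb_eqmod v e; rewrite z1 (m1 p2.+1); last by slia.
  case: (i =P B) => [ei|nB] b0 l0.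
    have h : i = p2.+1 by apply: eqmod_window e _ _; slia.
    by slia.
  case: (i =P B.+1) => [ei|nB1]; last by move: l0; rewrite lv2; slia.
  by have := bv2 i ltac:(slia); rewrite b0.
have lgi : forall j, j = g2 %[mod n] -> load v j = 0 /\ getb v j.
  by move=> j e; rewrite (load_eqmod lv e) (getb_eqmod v e).
(* In [x2] the ones of the other slot form a run of length [s1.-1], or [s1.-2] if the one at [g2] is
   the first of them; both are below [s2]. For [s1 = 2] the latter run is empty, and the clause of
   [slotted] about the bit after [g2] is contradicted instead. *)
case: (B.+1 %% n =P g2 %% n) => eg; last first.
  have r2 : xrun x2 true B s1.-1.
    apply/xrunP; split.
    - by rewrite bx2 ?vB; [case: ifP | slia].
    - move=> i hi; rewrite bx2; last by slia.
      case: eqP => [e|_]; last by apply: bv2; slia.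
      have [l0 _] := lgi _ e; move: l0; rewrite lv2; last by slia.
      by move=> l0; case: eg; rewrite -e; congr (_ %% _); slia.
    - by rewrite (_ : (B + s1.-1).+1 = B + s1) ?bx2 ?bv3; [case: ifP | slia | slia].
  by have := longruns_xrun n0 lr2 (_ : 0 < s1.-1) r2; slia.
case: (s1 =P 2) => e2.
  have eg2 : g2 = B.+1.
    by apply/esym; apply: eqmod_window eg _ _; slia.
  have := hg1 ltac:(slia); rewrite eg2 (_ : B.+2 = B + s1) ?bv3 //; slia.
have r2 : xrun x2 true B.+1 s1.-2.
  apply/xrunP; split.
  - by rewrite bx2 ?eg ?eqxx //; slia.
  - move=> i hi; rewrite bx2; last by slia.
    case: eqP => [e|_]; last by apply: bv2; slia.
    by have [l0 _] := lgi _ e; move: l0; rewrite lv2; slia.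
  - by rewrite (_ : (B.+1 + s1.-2).+1 = B + s1) ?bx2 ?bv3; [case: ifP | slia | slia].
by have := longruns_xrun n0 lr2 (_ : 0 < s1.-2) r2; slia.
Qed.

(** Even slots occur only in a [ylow], whence the load 1 at [p1]. The condition on [load v p2]
    covers both kinds of odd slot: this load is 0 for [uhigh], and the moved one of a [ylow] lies
    beyond the end of its slot. The bit at [B] is either the first zero of the even slot or the
    moved one of the odd slot. *)
Lemma even_odd_slotted x1 p1 s1 x2 p2 s2 g2 v a B :
  event k x1 p1 s1 -> event k x2 p2 s2 -> n <= p1 -> n <= p2 ->
  ~~ odd s1 -> odd s2 -> window s1 p1 B -> window s2 p2 B ->
  slotted k x1 p1 s1 v (a + n) -> slotted k x2 p2 s2 v g2 ->
  load v p1 = 1 -> (g2 = p2 + s2.*2 -> load v p2 = 0) ->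
  a < p1 < a + n -> load v a = 0 ->
  (forall i, a < i <= p1 -> 0 < load v i) -> False.
Proof.
move=> hev1 hev2 np1 np2 os1 os2; rewrite /window os2 (negbTE os1) => w1 w2.
move=> h1 h2 lp1 lp2 ha la hpos.
have s10 := event_s0 hev1; have s20 := event_s0 hev2.
have s11 : 1 < s1 by slia.
have [_ [y0 y1 y2 y3 [n1 n2]] _ _ _] := h1.
have [_ [z0 z1 z2 z3 [m1 m2]] vend _ _] := h2.
case: (B =P p1.+1) => eB.
  have vB : getb v p1.+1 = false by [].
  have lB : load v B = 0 by rewrite n1; slia.
  have eB2 : B = p2 + s2.*2 by move: lB; rewrite m2; slia.
  case: (s2 =P 1) => es2.
    by have := m1 p2.+1 ltac:(slia); rewrite (_ : p2.+1 = p1) ?lp1; slia.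
  by apply: (even_odd_clash hev1 hev2 np1 np2 s11 _ _ h1 h2 vB ha la hpos); slia.
have vB : getb v B by apply: y2; slia.
have eB2 : B = p2 + s2.*2.
  by case: (ltngtP B (p2 + s2.*2)) => // h; [move: vB; rewrite z3 //; slia | slia].
have eg : g2 = p2 + s2.*2 by move: vB; rewrite eB2 vend => /eqP.
have vB1 : getb v B.-1 = false.
  case: (s2 =P 1) => es2; last by apply: z3; slia.
  by rewrite (_ : B.-1 = p2.+1) //; slia.
have eB1 : B = p1.+2.
  case: (ltngtP B p1.+2) => // h; first by slia.
  by move: vB1; rewrite y2 //; slia.
case: (s2 =P 1) => es2.
  by have := lp2 eg; rewrite (_ : p2 = p1) ?lp1; slia.
by have := n1 p1.+1 ltac:(slia); rewrite (_ : p1.+1 = B.-1) ?m2; slia.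
Qed.

Implicit Types z : bstr n * nat * nat.

Definition wevent B z := [&& event k z.1.1 z.1.2 z.2, n <= z.1.2 & window z.2 z.1.2 B].

(** The events at which [uhigh] may be used: odd [s] makes it decodable, and an unchanged load
    maximum separates the high gap from the low one. *)
Definition exits z := odd z.2 && (maxload (ylow z.1.1 z.1.2) == maxload z.1.1).

Section TwoEvents.
Variables (B : nat) (x1 x2 : bstr n) (p1 p2 s1 s2 : nat).
Hypotheses (h1 : wevent B (x1, p1, s1)) (h2 : wevent B (x2, p2, s2)).

Let hev1 : event k x1 p1 s1. Proof. by case/and3P: h1. Qed.
Let hev2 : event k x2 p2 s2. Proof. by case/and3P: h2. Qed.
Let np1 : n <= p1. Proof. by case/and3P: h1. Qed.
Let np2 : n <= p2. Proof. by case/and3P: h2. Qed.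
Let w1 : window s1 p1 B. Proof. by case/and3P: h1. Qed.
Let w2 : window s2 p2 B. Proof. by case/and3P: h2. Qed.
Let s10 := event_s0 hev1.
Let s20 := event_s0 hev2.

Lemma event_neq_ylow : x1 <> ylow x2 p2.
Proof.
move=> e; have hs := ylow_slotted k3n hev2 np2; rewrite -e in hs.
have [es eg _] := event_slotted_clash hev1 np1 w1 s20 hs w2.
by have := lowgap_bounds k3n hev2 np2; slia.
Qed.

(** In the case left by [event_slotted_clash], the filled gap of [uhigh x2 p2], which contains all
    its load maxima, lies over the block of [x1] at [p1]; but [peak_exists] gives [x1] a maximum
    outside that block. *)
Lemma event_neq_uhigh : exits (x2, p2, s2) -> x1 <> uhigh x2 p2.
Proof.
move=> /andP[_ /eqP hm] e; have hs := uhigh_slotted k3n hev2 np2 hm; rewrite -e in hs.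
have [es eg ep] := event_slotted_clash hev1 np1 w1 s20 hs w2.
have [G' [hP G'n hpos _ htop]] := uhigh_top k3n hev2 np2 hm.
have lp := uhigh_load_p k3n hev2 np2 hm.
rewrite -e in hpos htop lp.
have lend := event_load_down k3n hev1 np1 (i := (p1 + s1.*2).+1) ltac:(slia).
have G'le : G' <= p1 + s1.*2.
  rewrite leqNgt; apply/negP => h.
  by have := hpos (p1 + s1.*2).+1; rewrite lend; slia.
have [P hP1 eP] := peak_exists k3n hev1 np1.
case: (P =P p2 + n) => eP2.
  have := maxload_gt0 k3n hev1 np1.
  by rewrite -eP eP2 loadDn ?lp //; apply: (event_light k3n hev1 np1).
by have := htop P ltac:(slia) eP; slia.
Qed.

Lemma ylow_inj : ylow x1 p1 = ylow x2 p2 -> x1 = x2.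
Proof.
move=> e; have hs1 := ylow_slotted k3n hev1 np1; have hs2 := ylow_slotted k3n hev2 np2.
have l1 := ylow_load_p k3n hev1 np1; have l2 := ylow_load_p k3n hev2 np2.
have [a1 a2 a3] := ylow_lowgap k3n hev1 np1; have [b1 b2 b3] := ylow_lowgap k3n hev2 np2.
have g1 := lowgap_bounds k3n hev1 np1; have g2 := lowgap_bounds k3n hev2 np2.
rewrite -e in hs2 l2 b2 b3.
case o1: (odd s1); case o2: (odd s2).
- have ep := slotted_slotted s10 s20 hs1 hs2 (etrans o1 (esym o2)) w1 w2.
  rewrite -ep in b1 b2 b3 hs2.
  have ea : lowgap x1 p1 = lowgap x2 p1.
    case: (ltngtP (lowgap x1 p1) (lowgap x2 p1)) => // h.
      by have := a3 (lowgap x2 p1); rewrite b2; slia.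
    by have := b3 (lowgap x1 p1); rewrite a2; slia.
  by have [_ _ _ _ ex1] := hs1; have [_ _ _ _ ex2] := hs2; rewrite ex1 ex2 ea.
- exfalso; apply: (even_odd_slotted hev2 hev1 np2 np1 (negbT o2) o1 w2 w1 hs2 hs1 l2 _ b1 b2 b3).
  by slia.
- exfalso; apply: (even_odd_slotted hev1 hev2 np1 np2 (negbT o1) o2 w1 w2 hs1 hs2 l1 _ a1 a2 a3).
  by slia.
- have ep := slotted_slotted s10 s20 hs1 hs2 (etrans o1 (esym o2)) w1 w2.
  rewrite -ep in b1 b2 b3 hs2.
  have ea : lowgap x1 p1 = lowgap x2 p1.
    case: (ltngtP (lowgap x1 p1) (lowgap x2 p1)) => // h.
      by have := a3 (lowgap x2 p1); rewrite b2; slia.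
    by have := b3 (lowgap x1 p1); rewrite a2; slia.
  by have [_ _ _ _ ex1] := hs1; have [_ _ _ _ ex2] := hs2; rewrite ex1 ex2 ea.
Qed.

Lemma uhigh_inj : exits (x1, p1, s1) -> exits (x2, p2, s2) ->
  uhigh x1 p1 = uhigh x2 p2 -> x1 = x2.
Proof.
move=> /andP[/= o1 /eqP hm1] /andP[/= o2 /eqP hm2] e.
have hs1 := uhigh_slotted k3n hev1 np1 hm1; have hs2 := uhigh_slotted k3n hev2 np2 hm2.
have [G1 [a1 a2 a3 a4 a5]] := uhigh_top k3n hev1 np1 hm1.
have [G2 [b1 b2 b3 b4 b5]] := uhigh_top k3n hev2 np2 hm2.
rewrite -e in hs2 b3 b4 b5.
have ep := slotted_slotted s10 s20 hs1 hs2 (etrans o1 (esym o2)) w1 w2.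
rewrite -ep in hs2 b1 b2 b3 b4 b5.
have [_ _ _ [c1 _ c2 _] ex1] := hs1; have [_ _ _ [d1 _ d2 _] ex2] := hs2.
have q1 := b5 _ _ a4; have {}q1 := q1 ltac:(slia).
have eg : highgap x1 p1 = highgap x2 p1.
  case: (ltngtP (highgap x1 p1) (highgap x2 p1)) => // h.
    by have := a3 (highgap x2 p1); rewrite d2; slia.
  by have := b3 (highgap x1 p1); rewrite c2; slia.
by rewrite ex1 ex2 eg.
Qed.

Lemma ylow_neq_uhigh : exits (x2, p2, s2) -> ylow x1 p1 <> uhigh x2 p2.
Proof.
move=> /andP[/= o2 /eqP hm2] e.
have hs1 := ylow_slotted k3n hev1 np1; have hs2 := uhigh_slotted k3n hev2 np2 hm2.
have l1 := ylow_load_p k3n hev1 np1; have l2 := uhigh_load_p k3n hev2 np2 hm2.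
have [a1 a2 a3] := ylow_lowgap k3n hev1 np1.
rewrite -e in hs2 l2; case o1: (odd s1).
  have ep := slotted_slotted s10 s20 hs1 hs2 (etrans o1 (esym o2)) w1 w2.
  by rewrite -ep l1 in l2.
exact: (even_odd_slotted hev1 hev2 np1 np2 (negbT o1) o2 w1 w2 hs1 hs2 l1 (fun=> l2) a1 a2 a3).
Qed.

End TwoEvents.

End Decoding.

(** * Choice of the connectors *)

Section Assembly.
Variables (n k : nat).
Hypothesis k0 : 0 < k.
Hypothesis k3n : k.*2 + 3 <= n.
Let k2n : k.*2 < n. Proof. by slia. Qed.
Let n0 : 0 < n. Proof. by slia. Qed.
Implicit Types x y v w : bstr n.

Local Notation B := (n + n).
(** With the window placed at [n + n], all admissible [p] satisfy [n <= p], so a full period below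
    [p] is available without truncation. *)
Definition ev : finType := (bstr n * 'I_(n + n) * 'I_n)%type.
Implicit Types t : ev.
Definition evx t : bstr n := t.1.1.
Definition evp t : nat := t.1.2.
Definition evs t : nat := t.2.
Definition isev t := wevent k B (evx t, evp t, evs t).
Definition evy t := ylow (evx t) (evp t).
Definition evu t := uhigh (evx t) (evp t).

Lemma isevP t : isev t -> [/\ event k (evx t) (evp t) (evs t), n <= evp t & window (evs t) (evp t) B].
Proof. by case/and3P. Qed.

Lemma isev_inX t : isev t -> inX k (evx t).
Proof. by case/isevP => /event_inX. Qed.

Lemma evy_inX t : isev t -> inX k (evy t).
Proof. by case/isevP => hev np _; case: (ylow_slotted k3n hev np). Qed.

(** The predicate depends only on the cycle of [v], so all strings of a cycle pick the same
    event. *)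
Definition rep v : option ev := [pick t | samecycle v (evx t) && isev t].

Lemma rep_exists v : inX k v -> ~~ is_sword k v ->
  exists t, [/\ rep v = Some t, samecycle v (evx t) & isev t].
Proof.
move=> hv nsw; have lv := inX_light k2n hv.
have hc : 0 < count id v by rewrite (eqP hv).
have [s [b [a [s0 hs hr]]]] := ex_xrun lv hc.
(* Chosen so that [W <= q < W + s] says the same as [window s q B]. *)
pose W := if odd s then B - s.*2 else B - s.
have [y [q [hy ys hq yr yf]]] := window_event k2n W hv s0 hs hr.
have Xy := samecycle_inX k2n hv hy.
have sk : s <= k by rewrite -(eqP Xy); apply: xrun_true_le yr.
have hqB : q < B by move: hq; rewrite /W; case: ifP => _; slia.
have sn : s < n by slia.
have ht : samecycle v (evx (y, Ordinal hqB, Ordinal sn)) && isev (y, Ordinal hqB, Ordinal sn).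
  rewrite hy /isev /wevent /event /evx /evp /evs /= Xy s0 ys yf yr.
  rewrite (is_sword_orbit k2n hv hy) nsw /= /window.
  by move: hq; rewrite /W; case: ifP => _; slia.
rewrite /rep; case: pickP => [t /andP[h1 h2]|h]; first by exists t.
by have := h (y, Ordinal hqB, Ordinal sn); rewrite ht.
Qed.

Lemma rep_samecycle v w : inX k v -> samecycle v w -> rep v = rep w.
Proof.
move=> hv hvw; apply: eq_pick => t; congr (_ && _).
apply/idP/idP => h; last exact: samecycle_trans hvw h.
exact: samecycle_trans (samecycle_sym k2n hv hvw) h.
Qed.

Lemma rep_some v t : rep v = Some t -> samecycle v (evx t) /\ isev t.
Proof. by rewrite /rep; case: pickP => // u /andP[h1 h2] [<-]. Qed.

Definition isrep t := rep (evx t) == Some t.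

Lemma isrep_isev t : isrep t -> isev t.
Proof. by move=> /eqP /rep_some[]. Qed.

Lemma rep_isrep v t : inX k v -> rep v = Some t -> isrep t.
Proof. by move=> hv h; have [h1 _] := rep_some h; rewrite /isrep -(rep_samecycle hv h1) h. Qed.

Lemma isrep_inj t t' : isrep t -> isrep t' -> evx t = evx t' -> t = t'.
Proof. by move=> /eqP h /eqP h' e; move: h; rewrite e h' => -[]. Qed.

(** The default makes [t] a fixed point when [evy t] is a sword. *)
Definition next t : ev := odflt t (rep (evy t)).

Definition selectable t :=
  exits (evx t, evp t, evs t) && ~~ is_sword k (evy t).

(* One selectable representative on each [next]-cycle that has any. *)
Definition sel t := [&& selectable t, fconnect next (next t) t &
  [pick u | selectable u && fconnect next t u] == Some t].

Definition edge t : {set bstr n} :=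
  if sel t then
    if highgap (evx t) (evp t) == evp t + (evs t).*2
    then [set evu t; evy t] else [set evx t; evu t]
  else [set evx t; evy t].

Definition edges : {set {set bstr n}} := [set P | [exists t, isrep t && (P == edge t)]].

Lemma edgesP P : reflect (exists2 t, isrep t & P = edge t) (P \in edges).
Proof.
rewrite inE; apply: (iffP existsP) => [[t /andP[h /eqP ->]]|[t h ->]]; exists t => //.
by rewrite h eqxx.
Qed.

Lemma mem_edge v t : v \in edge t ->
  [\/ v = evx t, v = evy t | exits (evx t, evp t, evs t) /\ v = evu t].
Proof.
rewrite /edge; case: ifP => [/and3P[/andP[h _] _ _]|_].
  case: ifP => _; rewrite !inE => /orP[/eqP ->|/eqP ->].
  - by apply: Or33.
  - by apply: Or32.
  - by apply: Or31.
  by apply: Or33.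
by rewrite !inE => /orP[/eqP ->|/eqP ->]; [apply: Or31 | apply: Or32].
Qed.

(** The nine cases are the pairs of roles a common vertex can play in the two edges; only equal
    roles survive, and they determine the string [evx t]. *)
Lemma edge_inj t t' v : isrep t -> isrep t' -> v \in edge t -> v \in edge t' -> t = t'.
Proof.
move=> r r' h h'; apply: isrep_inj => //.
have i := isrep_isev r; have i' := isrep_isev r'.
case: (mem_edge h) (mem_edge h') => [->|->|[e ->]] [e1|e1|[e' e1]].
- by [].
- by case: (event_neq_ylow k3n i i' e1).
- by case: (event_neq_uhigh k3n i i' e' e1).
- by case: (event_neq_ylow k3n i' i (esym e1)).
- exact: (ylow_inj k3n i i' e1).
- by case: (ylow_neq_uhigh k3n i i' e' e1).
- by case: (event_neq_uhigh k3n i' i e (esym e1)).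
- by case: (ylow_neq_uhigh k3n i' i e (esym e1)).
exact: (uhigh_inj k3n i i' e e' e1).
Qed.

Lemma edges_disjoint P Q : P \in edges -> Q \in edges -> P != Q -> [disjoint P & Q].
Proof.
move=> /edgesP[t r ->] /edgesP[t' r' ->] ne; apply/pred0P => v /=.
apply/negP => /andP[h h']; case/negP: ne; apply/eqP.
by rewrite (edge_inj r r' h h').
Qed.

Lemma edge_connector P : P \in edges -> is_connector k P.
Proof.
move=> /edgesP[t r ->]; have [hev np _] := isevP (isrep_isev r).
rewrite /edge; case: ifP => [/and3P[/andP[/andP[_ /eqP hm] _] _ _]|_].
  by have := connector_exit k3n hev np hm; case: ifP => _ h; [exists (evu t), (evy t) | exists (evx t), (evu t)].
by exists (evx t), (evy t); split => //; apply: connector_xy k3n hev np.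
Qed.

(** For [s = 1] the window makes [p.+1] congruent to [n.-1], a free position of [v] that would be
    matched in the sword. For larger [s] there are two descents, one in the slot and one after the
    moved one, whereas a sword has a single one. *)
Lemma slotted_not_sword x p s v g i : 0 < s -> slotted k x p s v g -> window s p B ->
  n <= p -> n - k.*2 <= i < n -> v <> sword n k i.
Proof.
move=> s0 [Xv [v0 v1 v2 v3 [l1 l2]] _ [hg vg _ _] _] hw np hi ev.
have lv := inX_light k2n Xv.
case: (s =P 1) hw => [->|s1] hw.
  have f : free v p.+1 by rewrite /free v1 l1; slia.
  move: hw; rewrite /window /= => hw.
  have := sword_last_matched k2n hi; rewrite -ev.
  by rewrite -(freeDn n.-1 lv) (_ : n.-1 + n = p.+1) ?f //; slia.
have [l hl1 hl2] : exists2 l, g <= l < p + n & getb v l && ~~ getb v l.+1.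
  have exl : exists l, getb v l && (l < p + n) by exists g; rewrite vg; case/andP: hg.
  have ub l : getb v l && (l < p + n) -> l <= p + n by case/andP => _; slia.
  case: (ex_maxnP exl ub) => l /andP[h1 h2] hm; exists l.
    by rewrite h2 andbT; apply: hm; rewrite vg; case/andP: hg.
  rewrite h1; apply/negP => h; case: (l.+1 =P p + n) => e.
    by move: h; rewrite e getbDn v0.
  by have := hm l.+1; rewrite h; slia.
case/andP: hl2 => hl2 hl3.
have d1 : getb v (p + s) by apply: v2; slia.
have d2 : ~~ getb v (p + s).+1 by rewrite v3 //; slia.
rewrite ev in hl2 hl3 d1 d2.
have := eqmod_window (sword_descent k2n d1 d2 hl2 hl3); slia.
Qed.

Lemma edge_not_sword v t i : isrep t -> v \in edge t -> n - k.*2 <= i < n -> v <> sword n k i.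
Proof.
move=> r h hi; have [hev np hw] := isevP (isrep_isev r); have s0 := event_s0 hev.
case: (mem_edge h) => [->|->|[/andP[_ /eqP hm] ->]].
- case/and5P: (hev) => _ /negP nsw _ _ _ e; apply: nsw; apply/is_swordP; first exact: k2n.
  by exists i.
- exact: (slotted_not_sword s0 (ylow_slotted k3n hev np) hw np hi).
exact: (slotted_not_sword s0 (uhigh_slotted k3n hev np hm) hw np hi).
Qed.

Lemma edges_Spair P j : P \in edges -> j < (gcdn n k).-1 -> [disjoint P & Spair n k (n - k.*2) j].
Proof.
move=> /edgesP[t r ->] hj; apply/pred0P => v /=; apply/negP => /andP[h].
have gk : gcdn n k <= k by apply: dvdn_leq => //; apply: dvdn_gcdr.
by rewrite !inE => /orP[]/eqP; apply: (edge_not_sword r h); slia.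
Qed.

(** * Connectedness *)

Local Notation H := (Hrel k edges).
Local Notation d := (sword n k 0).

Lemma Hrel_sym : symmetric H.
Proof.
have imp x y : H x y -> H y x.
  case/and3P => hx hy h; rewrite /Hrel hx hy /=.
  case/orP: h => [/orP[/andP[h1 h2]|h]|h].
  - by rewrite /samenode h1 h2.
  - by rewrite /samenode (samecycle_sym k2n hx h) orbT.
  by rewrite setUC h orbT.
by move=> x y; apply/idP/idP; apply: imp.
Qed.

Lemma H_sym x y : connect H x y = connect H y x.
Proof. exact: sym_connect_sym Hrel_sym x y. Qed.

Lemma H_cycle x y : inX k x -> samecycle x y -> connect H x y.
Proof.
move=> hx h; apply: connect1.
by rewrite /Hrel hx (samecycle_inX k2n hx h) /samenode h !orbT.
Qed.

Definition good v := connect H v d.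

Lemma good_connect v w : connect H v w -> good v = good w.
Proof.
move=> h; apply/idP/idP => hg; last exact: connect_trans h hg.
by rewrite H_sym in h; apply: connect_trans h hg.
Qed.

Lemma good_sword v : is_sword k v -> good v.
Proof.
move=> /(is_swordP k2n) [i ->]; apply: connect1.
by rewrite /Hrel !inX_sword // /samenode !inD_sword.
Qed.

Lemma connect_edge x y t : isrep t -> edge t = [set x; y] -> inX k x -> inX k y ->
  connect H x y.
Proof.
move=> r e hx hy; apply: connect1; rewrite /Hrel hx hy /=; apply/orP; right.
by apply/edgesP; exists t.
Qed.

Lemma next_rep t : isrep t -> ~~ is_sword k (evy t) ->
  [/\ isrep (next t), samecycle (evy t) (evx (next t)) & rep (evy t) = Some (next t)].
Proof.
move=> r nsw; have Xy := evy_inX (isrep_isev r).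
have [t' [e h i]] := rep_exists Xy nsw.
by rewrite /next e; split => //; apply: rep_isrep e.
Qed.

Lemma rep_sword v : inX k v -> is_sword k v -> rep v = None.
Proof.
move=> hv hsw; rewrite /rep; case: pickP => // t /andP[h1 /isevP[hev _ _]].
by case/and5P: hev => _; rewrite (is_sword_orbit k2n hv h1) hsw.
Qed.

Lemma next_isrep t : isrep t -> isrep (next t).
Proof.
move=> r; case: (boolP (is_sword k (evy t))) => h; last by case: (next_rep r h).
by rewrite /next rep_sword // evy_inX // isrep_isev.
Qed.

Lemma iter_next_isrep i t : isrep t -> isrep (iter i next t).
Proof. by move=> r; elim: i => [//|i ih]; rewrite iterS; apply: next_isrep. Qed.

Lemma good_next t : isrep t -> ~~ sel t -> good (evx t) = good (evx (next t)).
Proof.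
move=> r ns; have i := isrep_isev r; have Xy := evy_inX i.
case: (boolP (is_sword k (evy t))) => hsw.
  by rewrite /next rep_sword.
have [r' h _] := next_rep r hsw.
apply: good_connect; apply: connect_trans (H_cycle Xy h).
by apply: (connect_edge r) => //; [rewrite /edge (negbTE ns) | apply: isev_inX].
Qed.

Lemma sel_unique t t' : sel t -> sel t' -> fconnect next t t' -> fconnect next t' t -> t = t'.
Proof.
move=> /and3P[_ _ /eqP p1] /and3P[_ _ /eqP p2] h h'.
have e : [pick u | selectable u && fconnect next t u] = [pick u | selectable u && fconnect next t' u].
  apply: eq_pick => u; congr (_ && _).
  by apply/idP/idP => hu; [apply: connect_trans h' hu | apply: connect_trans h hu].
by move: p1; rewrite e p2 => -[].
Qed.

(** If the edge is {u, y}, only [y] profits directly from the larger load of [u]. Then [next] is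
    followed from [next t] around the circle back to [t]: no other event on it is selected, so each
    keeps its edge {x, y} and passes goodness on. *)
Lemma sel_good t : isrep t -> sel t ->
  (forall w, inX k w -> maxload (evx t) < maxload w -> good w) -> good (evx t).
Proof.
move=> r st ih; have i := isrep_isev r; have [hev np _] := isevP i.
have Xx := isev_inX i; have Xy := evy_inX i.
have [/andP[/andP[_ /eqP hm] nsw] per _] := and3P st.
have [Xu _ _ _ _] := uhigh_slotted k3n hev np hm.
have [mu _] := maxload_uhigh k3n hev np.
have gu : good (evu t) by apply: ih => //; rewrite /evu mu.
have := @connect_edge _ _ t r; rewrite /edge st; case: ifP => _ hc; last first.
  by rewrite (good_connect (hc _ _ erefl Xx Xu)).
have gy : good (evy t) by rewrite -(good_connect (hc _ _ erefl Xu Xy)).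
have [r1 h1 _] := next_rep r nsw.
have g1 : good (evx (next t)) by rewrite -(good_connect (H_cycle Xy h1)).
have hit := iter_findex per.
suff : forall j, j <= findex next (next t) t -> good (evx (iter j next (next t))).
  by move=> /(_ _ (leqnn _)); rewrite hit.
elim=> [//|j ihj] hj.
rewrite iterS -good_next; [by apply: ihj; apply: ltnW | exact: iter_next_isrep |].
apply/negP => sj.
have c1 : fconnect next t (iter j next (next t)).
  by rewrite -iterSr; apply: fconnect_iter.
have c2 : fconnect next (iter j next (next t)) t.
  rewrite -{2}hit -(subnK (ltnW hj)) iterD; apply: fconnect_iter.
have e := sel_unique st sj c1 c2.
have := findex_iter (ltn_trans hj (findex_max per)).
by rewrite -e => ej; rewrite ej ltnn in hj.
Qed.


Lemma minrun_orbit x y s s' b b' c c' : inX k x -> samecycle x y -> 0 < s -> 0 < s' ->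
  longruns s x -> xrun x b c s -> longruns s' y -> xrun y b' c' s' -> s = s'.
Proof.
move=> hx h s0 s0' l1 r1 l2 r2; apply/eqP; rewrite eqn_leq; apply/andP; split.
  exact: longruns_xrun n0 (longruns_orbit k2n hx h l1) s0' r2.
have hy := samecycle_inX k2n hx h; have h' := samecycle_sym k2n hx h.
exact: longruns_xrun n0 (longruns_orbit k2n hy h' l2) s0 r1.
Qed.

Definition bad M t := [&& isrep t, ~~ good (evx t) & maxload (evx t) == M].

Section Level.
Variable M : nat.
Hypothesis ih : forall w, inX k w -> M < maxload w -> good w.

Lemma bad_nsel t : bad M t -> ~~ sel t.
Proof.
move=> /and3P[r ng /eqP hM]; apply/negP => st; case/negP: ng.
by apply: sel_good r st _; rewrite hM.
Qed.

(** An event that is not selected has the edge {x, y}, so its [y] is not good either; hence [y] is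
    no sword and its maximal load does not exceed [M]. *)
Lemma bad_next t : bad M t ->
  [/\ bad M (next t), ~~ is_sword k (evy t), maxload (evy t) = maxload (evx t)
    & samecycle (evy t) (evx (next t))].
Proof.
move=> hb; have ns := bad_nsel hb; case/and3P: hb => r ng /eqP hM.
have i := isrep_isev r; have [hev np _] := isevP i.
have Xx := isev_inX i; have Xy := evy_inX i.
have ngy : ~~ good (evy t).
  rewrite -(good_connect (_ : connect H (evx t) (evy t))) //.
  by apply: connect_edge r _ Xx Xy; rewrite /edge (negbTE ns).
have my : maxload (evy t) = M.
  apply/eqP; rewrite eqn_leq -{2}hM (maxload_ylow k3n hev np) andbT leqNgt.
  by apply/negP => h; case/negP: ngy; apply: ih.
have nsw : ~~ is_sword k (evy t) by apply/negP => h; case/negP: ngy; apply: good_sword.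
have [r' h _] := next_rep r nsw; split => //; last by rewrite my hM.
rewrite /bad r' -(good_next r ns) ng /=.
by rewrite -(maxload_orbit k2n Xy h) my.
Qed.

Lemma bad_iter i t : bad M t -> bad M (iter i next t).
Proof. by move=> hb; elim: i => [//|i ih']; rewrite iterS; case: (bad_next ih'). Qed.

Lemma bad_selectable t : bad M t -> odd (evs t) -> selectable t.
Proof.
move=> hb o; have [_ nsw hm _] := bad_next hb.
by rewrite /selectable /exits /= o nsw -/(evy t) hm eqxx.
Qed.

Lemma bad_next_odd t : bad M t -> ~~ odd (evs t) -> odd (evs (next t)).
Proof.
move=> hb o; have [hb' nsw hm hc] := bad_next hb.
have [r _ _] := and3P hb; have [r' _ _] := and3P hb'.
have [hev np _] := isevP (isrep_isev r); have [hev' np' _] := isevP (isrep_isev r').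
have [s' [b [c [os ls xs]]]] := parity_step k3n hev np o.
have Xy := evy_inX (isrep_isev r).
have xr : xrun (evx (next t)) true (evp (next t)) (evs (next t)).
  by case/and5P: (hev') => _ _ _ _ /andP[].
have s0 : 0 < s' by case: (s') os.
by rewrite -(minrun_orbit Xy hc s0 (event_s0 hev') ls xs (event_longruns hev') xr).
Qed.

Lemma periodic_iter (T : finType) (f : T -> T) (x : T) :
  exists i, fconnect f (f (iter i f x)) (iter i f x).
Proof.
have /trajectP[i hi e] := looping_order f x.
exists i; rewrite -{2}e -iterS -(subnK hi) iterD; apply: fconnect_iter.
Qed.

Lemma periodic_back (T : finType) (f : T -> T) (x y : T) :
  fconnect f (f x) x -> fconnect f x y -> fconnect f y x.
Proof.
move=> /iter_findex; set m := findex _ _ _; rewrite -iterSr => e.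
have em c : iter (c * m.+1) f x = x.
  by elim: c => [//|c ih']; rewrite mulSn iterD ih' e.
move=> /iter_findex; set j := findex _ _ _ => <-.
rewrite -{2}(em j) -(subnK (_ : j <= j * m.+1)) ?leq_pmulr // iterD.
exact: fconnect_iter.
Qed.

(** The orbit of a bad event runs into a circle of bad events. An even one is followed by an odd
    one, and odd ones are selectable here, so the circle contains a selected event, against
    [bad_nsel]. *)
Lemma no_bad t : ~~ bad M t.
Proof.
apply/negP => hb; have [i per] := periodic_iter next t.
set c := iter i next t in per; have hc : bad M c := bad_iter i hb.
have [o [ho so oper]] : exists o, [/\ bad M o, selectable o & fconnect next (next o) o].
  case: (boolP (odd (evs c))) => oc; first by exists c; split => //; apply: bad_selectable.
  have [hn _ _ _] := bad_next hc.
  exists (next c); split => //; first by apply: bad_selectable => //; apply: bad_next_odd.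
  have := iter_findex per; set j := findex _ _ _ => e.
  by rewrite -{2}e -iterS iterSr; apply: fconnect_iter.
have [u hu eu] : exists2 u, selectable u && fconnect next o u &
    [pick u | selectable u && fconnect next o u] = Some u.
  case: pickP => [u hu|h]; first by exists u.
  by have := h o; rewrite so connect0.
case/andP: hu => su cu.
have hbu : bad M u by rewrite -(iter_findex cu); apply: bad_iter.
have cu' := periodic_back oper cu.
case/negP: (bad_nsel hbu); apply/and3P; split => //.
  apply: (connect_trans _ cu); apply: (periodic_back oper).
  exact: (connect_trans cu (fconnect1 _ _)).
rewrite -eu; apply/eqP/eq_pick => w; congr (_ && _).
by apply/idP/idP => h; [apply: (connect_trans cu h) | apply: (connect_trans cu' h)].
Qed.

End Level.

Lemma all_good v : inX k v -> good v.
Proof.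
have [N hN] := ubnP (n - maxload v); elim: N v hN => // N ih v hN hv.
case: (boolP (is_sword k v)) => nsw; first exact: good_sword.
have [t [e h i]] := rep_exists hv nsw; have r := rep_isrep hv e.
rewrite (good_connect (H_cycle hv h)).
have ihM w : inX k w -> maxload v < maxload w -> good w.
  move=> hw hlt; apply: ih => //.
  by have := maxload_le (inX_light k2n hw); slia.
have := no_bad ihM t; rewrite /bad r -(maxload_orbit k2n hv h) eqxx andbT /=.
by rewrite negbK.
Qed.

Lemma edges_connected : Hconnected k edges.
Proof.
move=> x y hx hy; apply: connect_trans (all_good hx) _.
by rewrite H_sym; apply: all_good.
Qed.

End Assembly.

Theorem mainTheorem13 (n k : nat) :
  1 <= k -> 2 * k + 3 <= n ->
  exists (U : {set {set bstr n}}) (r : nat),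
    [/\ r < n,
        (forall P, P \in U -> is_connector k P),
        (forall P Q, P \in U -> Q \in U -> P != Q -> [disjoint P & Q]),
        (forall P, P \in U -> forall j, j < (gcdn n k).-1 ->
            [disjoint P & Spair n k r j])
      & Hconnected k U].
Proof.
move=> k0; rewrite mul2n => k3n; exists (edges n k), (n - k.*2); split.
- by lia.
- exact: edge_connector.
- exact: edges_disjoint.
- by move=> P hP j; apply: edges_Spair.
- exact: edges_connected.
Qed.
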